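(* Let $\beta\in\mathbb R$. For $n\ge1$ let $\tau_n^\beta$ be a Mallows random permutation of size $n$ with parameter $q_n:=e^{\beta/n}$, conditioned to avoid $231$. Then the random function $\varphi_{\tau_n^\beta}$ satisfies a large deviation principle on $\mathcal E$ at speed $n$ with rate function $$\varphi\mapsto A_\beta(\varphi)-\inf_{\mathcal E}A_\beta,\qquad\text{where}\quad A_\beta(\varphi):=2\int_0^1J(\varphi'(t))\,\mathrm dt-2\beta\int_0^1\varphi(t)\,\mathrm dt.$$
   Context: A permutation $\sigma$ of $\{1,\dots,n\}$ is $231$-avoiding if there are no $i<j<k$ with $\sigma(k)<\sigma(i)<\sigma(j)$. The law of $\tau_n^\beta$ is supported on $231$-avoiding permutations $\sigma$ of size $n$ and $\mathbb P(\tau_n^\beta=\sigma)$ is proportional to $e^{\frac\beta n\mathrm{inv}(\sigma)}$, where $\mathrm{inv}$ is the number of inversions. $\mathcal E$ is the set of $1$-Lipschitz functions $\varphi:[0,1]\to[0,\infty)$ with $\varphi(0)=\varphi(1)=0$, with the supremum norm topology. Elements of $\mathcal E$ are a.e. differentiable with $|\varphi'|\le1$. For $y\in[-1,1]$, $J(y):=\frac12(1+y)\log(1+y)+\frac12(1-y)\log(1-y)$, with $0\log0=0$. For a $231$-avoiding $\sigma$ of size $n$, let $f_\sigma(x):=\frac1n\big(\min\{\sigma(c):c>nx\}-1\big)$ for $x\in[0,1)$ and $f_\sigma(1):=1$; its completed graph is $G_{f_\sigma}=\{(x,y)\in[0,1]^2:f_\sigma(x^-)\le y\le f_\sigma(x)\}$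 (convention $f_\sigma(0^-)=0$), and $\varphi_\sigma\in\mathcal E$ is the unique function with $G_{f_\sigma}=\{(t+\varphi_\sigma(t),t-\varphi_\sigma(t)):t\in[0,1]\}$. A sequence $(X_n)$ of random variables in a Polish space $E$ satisfies a large deviation principle at speed $a_n\to\infty$ with rate function $I:E\to[0,\infty]$ (lower semicontinuous) if $\limsup_n\frac1{a_n}\log\mathbb P(X_n\in F)\le-\inf_FI$ for every closed $F\subseteq E$ and $\liminf_n\frac1{a_n}\log\mathbb P(X_n\in O)\ge-\inf_OI$ for every open $O\subseteq E$. *)

(* Defs.v *)
From HB Require Import structures.
From mathcomp Require Import all_boot all_order all_algebra perm.
From mathcomp Require Import all_classical all_reals all_analysis.

Set Implicit Arguments.
Unset Strict Implicit.
Unset Printing Implicit Defensive.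

Import Order.TTheory GRing.Theory Num.Theory.
Import numFieldNormedType.Exports.

Local Open Scope classical_set_scope.
Local Open Scope ring_scope.

(* Permutations of {1, ..., n} are represented by permutations of
   'I_n = {0, ..., n-1}: the entry sigma(c) is (s i).+1 with c = i.+1. *)

Definition avoids231 (n : nat) (s : 'S_n) : bool :=
  [forall i : 'I_n, forall j : 'I_n, forall k : 'I_n,
     (i < j < k)%N ==> ~~ (s k < s i < s j)%N].

Definition inversions (n : nat) (s : 'S_n) : nat :=
  #|[pred p : 'I_n * 'I_n | (p.1 < p.2)%N && (s p.2 < s p.1)%N]|.

Definition mallows (R : realType) (n : nat) (q : R) (s : 'S_n) : R :=
  q ^+ inversions s / \sum_(r : 'S_n) q ^+ inversions r.

Definition mallows231 (R : realType) (n : nat) (q : R) (s : 'S_n) : R :=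
  if avoids231 s then mallows q s / \sum_(r : 'S_n | avoids231 r) mallows q r
  else 0.

(* A function on [0, 1] is represented by its extension by 0 to R; the clause
   on the complement of [0, 1] makes the representation unique.  The ambient
   topology is that of uniform convergence on [0, 1]. *)
Definition lip_excursions (R : realType) : set {uniform` `[0, 1]%classic -> R} :=
  [set phi : R -> R |
    [/\ 1.-lipschitz_(`[0, 1]%classic) phi,
        forall t : R, t \in `[0, 1] -> 0 <= phi t,
        phi 0 = 0,
        phi 1 = 0 &
        forall t : R, t \notin `[0, 1] -> phi t = 0]].

(* Carries the subspace topology of the library's instances for [set_type]. *)
Definition excursion (R : realType) := set_type (@lip_excursions R).

HB.instance Definition _ (R : realType) :=
  Uniform.copy (excursion R) (set_type (@lip_excursions R)).

Definition excursion_fun (R : realType) (phi : excursion R) : R -> R :=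
  set_val phi.

Coercion excursion_fun : excursion >-> Funclass.

Lemma lip_excursions0 (R : realType) :
  (fun _ : R => 0 : R) \in @lip_excursions R.
Proof.
apply/mem_set; split=> //= -[x y] _ /=.
by rewrite subrr normr0 mul1r.
Qed.

Definition excursion0 (R : realType) : excursion R :=
  exist (fun phi => phi \in @lip_excursions R) _ (lip_excursions0 R).

(* The default value n of the minimum is at least all the entries, hence is
   irrelevant when x < 1. *)
Definition future_min (R : realType) (n : nat) (s : 'S_n) (x : R) : R :=
  if x < 1 then
    ((\big[minn/n]_(i < n | n%:R * x < i.+1%:R) (s i).+1)%:R - 1) / n%:R
  else 1.

Definition left_limit (R : realType) (f : R -> R) (x : R) : R :=
  if x == 0 then 0 else lim (f y @[y --> x^'-]).

Definition completed_graph (R : realType) (f : R -> R) : set (R * R) :=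
  [set p | [/\ p.1 \in `[0, 1], p.2 \in `[0, 1] &
               left_limit f p.1 <= p.2 <= f p.1]].

Definition rotated_graph (R : realType) (phi : R -> R) : set (R * R) :=
  [set (t + phi t, t - phi t) | t in `[0, 1]].

(* [xget] selects the unique excursion with the required property; excursion0
   is only its formal default value. *)
Definition perm_excursion (R : realType) (n : nat) (s : 'S_n) : excursion R :=
  xget (excursion0 R)
    [set phi : excursion R |
      completed_graph (future_min s) = rotated_graph phi].

(* The clause on open sets says that the X n are random variables. *)
Definition large_deviation_principle (R : realType) (T : topologicalType)
    (d : nat -> measure_display) (Omega : forall n, measurableType (d n))
    (P : forall n, probability (Omega n) R) (X : forall n, Omega n -> T)
    (a : nat -> R) (I : T -> \bar R) : Prop :=
  [/\ (forall n (U : set T), open U -> measurable (X n @^-1` U)) /\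
        a @ \oo --> +oo,
      (forall x, 0 <= I x)%E /\ lower_semicontinuous I,
      forall F : set T, closed F ->
        (limn_esup (fun n => (a n)^-1%:E * lne (P n (X n @^-1` F)))
           <= - ereal_inf (I @` F))%E &
      forall U : set T, open U ->
        (- ereal_inf (I @` U)
           <= limn_einf (fun n => (a n)^-1%:E * lne (P n (X n @^-1` U))))%E].

Definition entropyJ (R : realType) (y : R) : R :=
  2^-1 * (1 + y) * ln (1 + y) + 2^-1 * (1 - y) * ln (1 - y).

Definition path_energy (R : realType) (beta : R) (phi : excursion R) : R :=
  2 * \int[lebesgue_measure]_(t in `[0, 1]) entropyJ (derive1 phi t)
  - 2 * beta * \int[lebesgue_measure]_(t in `[0, 1]) phi t.

(* Main.v *)
Require Import Defs.
From HB Require Import structures.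
From mathcomp Require Import all_boot all_order all_algebra perm.
From mathcomp Require Import all_classical all_reals all_analysis.
From mathcomp Require Import measurable_realfun.
From mathcomp Require Import ring lra zify.

Set Implicit Arguments.
Unset Strict Implicit.
Unset Printing Implicit Defensive.

(** Why the theorem is true.

    The future minimum of a 231-avoiding permutation of size [n] bounds a
    staircase, and the rotation by 45 degrees turns this staircase into a lattice
    path with [2 * n] steps of slope 1 or -1: the excursion of the permutation is
    the maximum of one tent for each entry ([completed_graph_staircase]), and on the
    grid of mesh [1 / (2 * n)] it is the Dyck path [height] divided by [2 * n]
    ([perm_excursion_grid]).  Every Dyck path comes from exactly one 231-avoiding
    permutation ([exists_height], [height_inj]), and the area under the path
    computes the inversions ([height_area]).  The Mallows weight is therefore, up to
    a bounded factor, the exponential of [2 * beta * n] times the area under the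
    excursion ([weight_bound]), a continuous functional.

    It remains to count the Dyck paths close to a given excursion [phi]; compared
    with all the paths of [2 * n] unit steps their proportion decays like the
    exponential of minus [2 * n] times the integral of [entropyJ] along the
    derivative of [phi].  For the upper bound, cut the path into [m] blocks and toss
    coins biased according to the slope of [phi] on each block: a path close to
    [phi] has a large probability, and the probabilities add up to at most one
    ([few_excursions], [upper_count]).  For the lower bound, prescribe the number of
    up-steps in each block; the number of such paths is a product of binomial
    coefficients, estimated by Stirling's formula, and two short ramps keep the
    paths nonnegative ([many_excursions], [shadowing_count]).

    Both counts involve the energy of the piecewise linear interpolation of [phi] at
    [m + 1] equidistant points.  As [m] grows, the slopes converge to the derivative
    of [phi] almost everywhere, and the energies converge by dominated convergence
    ([block_energy_cvg]).  The almost everywhere differentiability is obtained from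
    the Radon-Nikodym density of the Stieltjes measure of [t + phi t], which twice
    Lebesgue measure dominates ([excursion_ae_derivable]).

    Finally the space of excursions is compact ([excursion_compact]), and on a
    compact space local estimates of this kind give a large deviation principle,
    including the lower semicontinuity of the rate function and the value of the
    normalising constant ([local_lower_bound], [ldp_upper], [ldp_lower]). *)

(** * Lattice paths of 231-avoiding permutations *)

Lemma sum_ord_lt n c : c <= n -> \sum_(m < n) (m < c : nat) = c.
Proof.
move=> cn; rewrite -(big_mkord xpredT (fun m => (m < c : nat))).
rewrite (big_cat_nat (n := c))//= [X in _ + X]big_nat_cond [X in _ + X]big1 ?addn0.
  rewrite big_nat_cond (eq_bigr (fun=> 1)); last by move=> i /andP[/andP[_ ->]].
  by rewrite -big_nat_cond sum_nat_const_nat subn0 muln1.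
by move=> i /andP[/andP[ci _] _]; rewrite ltnNge ci.
Qed.

Lemma sum_ord_itv n u v : v <= n ->
  \sum_(c < n) ((u <= c) && (c < v) : nat) = v - u.
Proof.
move=> vn; have := sum_ord_lt vn; have := @sum_ord_lt n (minn u v).
move=> /(_ ltac:(lia)) su sv.
have : \sum_(c < n) ((u <= c) && (c < v) : nat) + \sum_(c < n) (c < minn u v : nat) =
    \sum_(c < n) (c < v : nat).
  by rewrite -big_split; apply: eq_bigr => c _ /=; lia.
lia.
Qed.

Section Heights.
Variable n : nat.
Implicit Type s : 'S_n.

(** The future minimum of [s] from position [c] on is the least [m] with
    [low s c m]; the predicate needs no default value at positions past the
    last one. *)
Definition low s (c m : nat) : bool := [exists i : 'I_n, (c <= i) && (s i <= m)].

Lemma lowP s c m : reflect (exists2 i : 'I_n, c <= i & s i <= m) (low s c m).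
Proof.
by apply: (iffP existsP) => [[i /andP[]]|[i ci im]]; exists i => //; rewrite ci.
Qed.

(** Pigeonhole: there are more positions from [c] on than values above [c]. *)
Lemma low_diag s c : c < n -> low s c c.
Proof.
move=> cn; apply: contraT => /lowP nlow.
pose A := [set i : 'I_n | c <= i]; pose B := [set i : 'I_n | c < i].
have : s @: A \subset B.
  apply/fintype.subsetP => j /imsetP[i]; rewrite !inE => ci ->.
  by rewrite ltnNge; apply/negP => si; apply: nlow; exists i.
move/subset_leq_card; rewrite card_imset; last exact: perm_inj.
move=> AB; suff /proper_card BA : B \proper A by rewrite -(ltnn #|A|) (leq_ltn_trans AB).
apply/properP; split; first by apply/fintype.subsetP => i; rewrite !inE => /ltnW.
by exists (Ordinal cn); rewrite !inE /= ?ltnn.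
Qed.

Lemma lowS s c m m' : m <= m' -> low s c m -> low s c m'.
Proof. by move=> mm /lowP[i ci im]; apply/lowP; exists i => //; lia. Qed.

(** After a rotation by 45 degrees and a scaling, the entry of [s] at position
    [i] becomes a tent of slopes 1 and -1 over the interval from [2 * s i] to
    [2 * i.+1].  The maximum of the tents is the lattice path that runs along
    the graph of the future minimum; truncated subtraction supplies the maximum
    with zero. *)
Definition height s (k : nat) : nat :=
  \max_(i < n) minn (k - 2 * s i) (2 * i.+1 - k).

Lemma heightP s k d : 0 < d ->
  reflect (exists2 i : 'I_n, 2 * s i + d <= k & k + d <= 2 * i.+1) (d <= height s k).
Proof.
move=> d0; apply: (iffP idP) => [dh|[i i1 i2]].
- have n0 : 0 < n.
    rewrite lt0n; apply/eqP => n0; have : height s k = 0.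
      by apply: big1 => i _; have := ltn_ord i; rewrite [X in _ < X]n0.
    by move=> h0; move: dh; rewrite h0 leqNgt d0.
  have I0 : 0 < #|'I_n| by rewrite card_ord.
  have [i E] := eq_bigmax (fun i : 'I_n => minn (k - 2 * s i) (2 * i.+1 - k)) I0.
  by move: dh; rewrite /height E => dh; exists i; lia.
- by apply: (leq_trans _ (leq_bigmax i)); lia.
Qed.

(** The cell in column [c] and row [m] of the diagram of [low] lies on the
    antidiagonal [m + c + 1] of the rotated picture. *)
Lemma low_height s c m : m <= c -> low s c m = (c.+1 - m <= height s (m + c + 1)).
Proof.
move=> mc; apply/lowP/heightP; rewrite ?subn_gt0//.
- by move=> [i ci im]; exists i; lia.
- by move=> [i ci im]; exists i; lia.
Qed.

Lemma height_le_id s k : height s k <= k.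
Proof. by apply/bigmax_leqP => i _; lia. Qed.

Lemma height_le_rev s k : height s k <= 2 * n - k.
Proof. by apply/bigmax_leqP => i _; have := ltn_ord i; lia. Qed.

Lemma heightS_le s k : height s k.+1 <= (height s k).+1.
Proof.
case E : (height s k.+1) => [//|d]; rewrite ltnS.
have [->//|d0] := posnP d.
have /heightP : d.+1 <= height s k.+1 by rewrite E.
by case=> // i i1 i2; apply/heightP => //; exists i; lia.
Qed.

Lemma height_leS s k : height s k <= (height s k.+1).+1.
Proof.
case E : (height s k) => [//|d]; rewrite ltnS.
have [->//|d0] := posnP d.
have /heightP : d.+1 <= height s k by rewrite E.
by case=> // i i1 i2; apply/heightP => //; exists i; lia.
Qed.

(** The feet of the tents are even.  A path that reached a height of the wrong
    parity would therefore reach one more, and height zero at an odd abscissa is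
    excluded by [low_diag]. *)
Lemma odd_height s k : k <= 2 * n -> odd (height s k) = odd k.
Proof.
move=> kn; have [h0|h0] := posnP (height s k).
  rewrite h0; apply/esym/negbTE/negP => ok.
  have kn2 : k./2 < n by have := odd_double_half k; rewrite ok; lia.
  have /lowP[i i1 i2] := low_diag s kn2.
  suff : 0 < height s k by rewrite h0.
  by apply/heightP => //; exists i; have := odd_double_half k; rewrite ok; lia.
have /heightP[//|i i1 i2] := leqnn (height s k).
apply/eqP; rewrite -[_ == _]negbK; apply/negP => par.
suff : (height s k).+1 <= height s k by rewrite ltnn.
by apply/heightP => //; exists i; move: par; lia.
Qed.

Lemma height_step s k : k < 2 * n ->
  height s k.+1 = (height s k).+1 \/ height s k = (height s k.+1).+1.
Proof.
move=> kn; have := heightS_le s k; have := height_leS s k.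
have := odd_height s (ltnW kn); have := odd_height s kn.
lia.
Qed.

Lemma height0 s : height s 0 = 0.
Proof. by have := height_le_id s 0; lia. Qed.

Lemma avoids231P s : reflect
  (forall i j k : 'I_n, i < j -> j < k -> s k < s i -> s i < s j -> False)
  (avoids231 s).
Proof.
apply: (iffP forallP) => [av i j k ij jk ki ikj|av i].
  have /forallP/(_ j)/forallP/(_ k) := av i.
  by rewrite ij jk /= ki ikj.
apply/forallP => j; apply/forallP => k; apply/implyP => /andP[ij jk].
by apply/negP => /andP[]; exact: av ij jk.
Qed.

(** For [b] before [c], avoiding 231 makes [s c < s b] equivalent to the
    existence of an entry at most [s b] from [c] on.  The values smaller than
    all the entries from [c] on sit before [c], and they are smaller than [c] by
    [low_diag].  Each side of the identity is thus [c] minus the number of these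
    values. *)
Lemma inversions_column s (c : 'I_n) : avoids231 s ->
  #|[pred b : 'I_n | (b < c) && (s c < s b)]| = \sum_(m < n) ((m < c) && low s c m).
Proof.
move=> /avoids231P av.
have lowE (b : 'I_n) : b < c -> low s c (s b) = (s c < s b).
  move=> bc; apply/lowP/idP => [[i ci ib]|cb]; last by exists c => //; lia.
  rewrite ltnNge; apply/negP => sbc.
  have nbi : i != b by apply/eqP => ib'; move: ci; rewrite ib'; lia.
  have nbc : b != c by apply/eqP => bc'; move: bc; rewrite bc'; lia.
  have nsbi : val (s i) != val (s b) by rewrite (inj_eq val_inj) (inj_eq perm_inj).
  have nsbc : val (s b) != val (s c) by rewrite (inj_eq val_inj) (inj_eq perm_inj).
  have nci : i != c by apply/eqP => ic; move: ib; rewrite ic; move: nsbc sbc => /=; lia.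
  have nci' : val i != val c by rewrite (inj_eq val_inj).
  by apply: (av b c i) => //=; move: nci' nsbi nsbc => /=; lia.
have nlow (m : 'I_n) : ~~ low s c m -> m < c.
  by apply: contraR; rewrite -leqNgt => cm; apply: lowS cm (low_diag s (ltn_ord c)).
have nlows (b : 'I_n) : ~~ low s c (s b) -> b < c.
  by apply: contraR; rewrite -leqNgt => cb; apply/lowP; exists b.
have e1 : \sum_(m < n) ((m < c) && low s c m) + \sum_(m < n) (~~ low s c m) = c.
  rewrite -big_split/=.
  transitivity (\sum_(m < n) (m < c)).
    apply: eq_bigr => m _; case E : (low s c m); first by rewrite andbT addn0.
    by rewrite andbF nlow ?E.
  by apply: sum_ord_lt; exact: ltnW.
have e2 : #|[pred b : 'I_n | (b < c) && (s c < s b)]| + \sum_(m < n) (~~ low s c (s m)) = c.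
  rewrite -sum1_card big_mkcond/= -big_split/= -[RHS](sum_ord_lt (ltnW (ltn_ord c))).
  apply: eq_bigr => b _; rewrite !inE; have [bc|cb] := ltnP b c.
    by rewrite /= lowE//; case: (s c < s b).
  by case E : (low s c (s b)) => //; have := nlows b; rewrite E => /(_ isT); lia.
have e3 : \sum_(m < n) (~~ low s c (s m)) = \sum_(m < n) (~~ low s c m) :> nat.
  by rewrite [RHS](reindex_inj (@perm_inj _ s)).
lia.
Qed.

Lemma inversions_sum s : avoids231 s ->
  inversions s = \sum_(c < n) \sum_(m < n) ((m < c) && low s c m).
Proof.
move=> av; under eq_bigr do rewrite -inversions_column//.
rewrite /inversions -sum1_card.
under [RHS]eq_bigr do rewrite -sum1_card.
rewrite (pair_big_dep xpredT (fun c b : 'I_n => (b < c) && (s c < s b)))/=.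
rewrite (reindex (fun p : 'I_n * 'I_n => (p.2, p.1)))/=; last first.
  by exists (fun p => (p.2, p.1)) => -[].
by apply: eq_bigl => -[b c].
Qed.

(** By [inversions_sum] the inversions are the cells of the diagram strictly
    below the diagonal.  The antidiagonal [k] carries [height s k] divided by two
    of them, rounded down, and it is the [n] odd antidiagonals that round. *)
Lemma height_area s : avoids231 s ->
  \sum_(k < 2 * n) height s k = 2 * inversions s + n.
Proof.
move=> av; rewrite inversions_sum//.
have colE (c : 'I_n) : \sum_(m < n) ((m < c) && low s c m) =
    \sum_(k < 2 * n) ((c < k) && (k <= 2 * c) && (2 * c.+1 - k <= height s k)).
  transitivity (\sum_(0 <= m < c) (c.+1 - m <= height s (m + c.+1) : nat)).
    rewrite -(big_mkord xpredT (fun m => (m < c) && low s c m : nat)).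
    rewrite (big_cat_nat (n := c)) ?(ltnW (ltn_ord c))//= [X in _ + X]big_nat_cond.
    rewrite [X in _ + X]big1 ?addn0; last first.
      by move=> i /andP[/andP[ci _] _]; rewrite ltnNge ci.
    rewrite big_nat_cond [RHS]big_nat_cond; apply: eq_bigr => m /andP[/andP[_ mc] _].
    by rewrite mc/= low_height ?(ltnW mc)// -addnA addn1.
  rewrite -(big_mkord xpredT (fun k => (c < k) && (k <= 2 * c) &&
     (2 * c.+1 - k <= height s k) : nat)).
  have := ltn_ord c => cn.
  rewrite [RHS](big_cat_nat (n := c.+1)); [|lia|lia].
  rewrite [X in _ = _ + X](big_cat_nat (n := c + c.+1)); [|lia|lia].
  rewrite [X in _ = X + _]big_nat_cond [X in _ = X + _]big1 ?add0n; last first.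
    by move=> k /andP[/andP[_ kc] _]; rewrite ltnNge -ltnS kc.
  rewrite [X in _ = _ + X]big_nat_cond [X in _ = _ + X]big1 ?addn0; last first.
    move=> k /andP[/andP[kc _] _].
    by rewrite (_ : (k <= 2 * c) = false) ?andbF//; lia.
  rewrite -{3}[c.+1]add0n big_addn addnK.
  rewrite big_nat_cond [RHS]big_nat_cond; apply: eq_bigr => m /andP[/andP[_ mc] _].
  have -> : (c < m + c.+1) by lia.
  have -> : (m + c.+1 <= 2 * c) by lia.
  by congr ((_ <= _) : nat); lia.
rewrite (eq_bigr _ (fun c _ => colE c)).
rewrite exchange_big/= big_distrr/=.
have oddsum : \sum_(k < 2 * n) (odd k : nat) = n.
  elim: (n) => [|p IHp]; first by rewrite muln0 big_ord0.
  by rewrite mulnS !big_ord_recr/= IHp; lia.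
rewrite -[X in _ = _ + X]oddsum -big_split/=; apply: eq_bigr => k _.
have kn := ltn_ord k.
have par := odd_height s (ltnW kn).
have le1 := height_le_id s k; have le2 := height_le_rev s k.
have -> : \sum_(c < n) ((c < k) && (k <= 2 * c) && (2 * c.+1 - k <= height s k)) =
    (k + height s k)./2 - uphalf k.
  rewrite -(@sum_ord_itv n); last by lia.
  apply: eq_bigr => c _; congr (nat_of_bool _); lia.
lia.
Qed.

(** At the last disagreement [c], the smaller of the two values, say [s c],
    occurs in [s'] before [c].  Since the future minima agree, [s'] also has an
    entry below [s c] after [c], which completes a 231 pattern. *)
Lemma low_inj s s' : avoids231 s -> avoids231 s' ->
  (forall c m, c < n -> low s c m = low s' c m) -> s = s'.
Proof.
move=> av av' e; apply/permP => c0.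
suff main k : forall (c : 'I_n), n <= c + k -> s c = s' c.
  by apply: (main n); rewrite leq_addl.
elim: k => [|k IHk] c nck; first by have := ltn_ord c; lia.
have agree (i : 'I_n) : c < i -> s i = s' i by move=> ci; apply: IHk; lia.
have lt_false (u u' : 'S_n) : avoids231 u' ->
    (forall m, low u c m = low u' c m) -> (forall i : 'I_n, c < i -> u i = u' i) ->
    u c < u' c -> False.
  move=> /avoids231P avu' eu agr lt.
  have : low u' c (u c) by rewrite -eu; apply/lowP; exists c.
  case/lowP => i ci iu.
  have ltci : c < i.
    rewrite ltn_neqAle ci andbT; apply/eqP => /val_inj ic.
    by move: iu; rewrite -ic leqNgt lt.
  have lti : u' i < u c.
    rewrite ltn_neqAle iu andbT -agr//.
    by rewrite (inj_eq val_inj) (inj_eq perm_inj); apply/eqP => E; rewrite E ltnn in ltci.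
  pose b := (u'^-1)%g (u c).
  have ub : u' b = u c by rewrite permKV.
  have bc : b < c.
    rewrite ltnNge; apply/negP; rewrite leq_eqVlt => /orP[/eqP/val_inj E|cb].
      by rewrite -ub -E ltnn in lt.
    by have := perm_inj (etrans (agr b cb) ub) => E; rewrite E ltnn in cb.
  by apply: (avu' b c i) => //; rewrite ub.
apply/val_inj/eqP; rewrite eqn_leq.
apply/andP; split; rewrite leqNgt; apply/negP.
  by apply: lt_false => //; [move=> m; rewrite e//|move=> i /agree].
by apply: lt_false => // m; rewrite e.
Qed.

Lemma height_inj s s' : avoids231 s -> avoids231 s' ->
  (forall k, k <= 2 * n -> height s k = height s' k) -> s = s'.
Proof.
move=> av av' e; apply: low_inj => // c m cn.
have [mc|cm] := leqP m c; first by rewrite !low_height// e//; lia.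
by rewrite !(lowS (ltnW cm) (low_diag _ cn)).
Qed.

End Heights.

(** * Permutations with a given Dyck path *)

(** The least unused value from [m] on; the search can stop at [m + size l],
    since at most [size l] values are used. *)
Definition first_free (m : nat) (l : seq nat) : nat :=
  nth 0 [seq v <- iota m (size l).+1 | v \notin l] 0.

Fixpoint greedy (ms : seq nat) : seq nat :=
  if ms is m :: ms' then first_free m (greedy ms') :: greedy ms' else [::].

Lemma first_freeP m l : [/\ m <= first_free m l, first_free m l <= m + size l,
  first_free m l \notin l & forall v, m <= v -> v < first_free m l -> v \in l].
Proof.
rewrite /first_free.
have : [seq v <- iota m (size l).+1 | v \notin l] != [::].
  apply/eqP => E.
  have sub : {subset iota m (size l).+1 <= l}.
    move=> v vi; apply: contraT => nv.
    have : v \in [seq v <- iota m (size l).+1 | v \notin l] by rewrite mem_filter nv.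
    by rewrite E.
  by have := uniq_leq_size (iota_uniq _ _) sub; rewrite size_iota ltnn.
have := sorted_filter ltn_trans (fun v => v \notin l) (iota_ltn_sorted m (size l).+1).
have memE v : (v \in [seq v <- iota m (size l).+1 | v \notin l]) =
    [&& v \notin l, m <= v & v <= m + size l].
  by rewrite mem_filter mem_iota addnS ltnS.
case: [seq v <- _ | _] memE => // v vs memE /= srt _.
have := memE v; rewrite inE eqxx/= => /esym/and3P[vl mv vm]; split=> // w mw wv.
apply: contraT => wl; have := memE w; rewrite wl mw/=.
have -> : w <= m + size l by lia.
rewrite inE => /orP[/eqP E|wvs]; first by rewrite E ltnn in wv.
have /allP/(_ w wvs) := order_path_min ltn_trans srt.
by move=> /= vw; lia.
Qed.

Lemma size_greedy ms : size (greedy ms) = size ms.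
Proof. by elim: ms => //= m ms ->. Qed.

Lemma uniq_greedy ms : uniq (greedy ms).
Proof. by elim: ms => //= m ms ->; have [_ _ ->] := first_freeP m (greedy ms). Qed.

Lemma drop_greedy c ms : drop c (greedy ms) = greedy (drop c ms).
Proof. by elim: ms c => [|m ms IH] [|c] //=. Qed.

Lemma nth_greedy ms c : c < size ms ->
  nth 0 (greedy ms) c = first_free (nth 0 ms c) (greedy (drop c.+1 ms)).
Proof.
by move=> cs; rewrite -[LHS]/(nth 0 (greedy ms) c) -{1}(addn0 c) -nth_drop drop_greedy
  (drop_nth 0 cs).
Qed.

(** Fill the positions from the last to the first, each with the least unused
    value allowed there.  At position [c] fewer than [n - c] values are used, so
    that [M c <= c] keeps the chosen value below [n]. *)
Lemma exists_greedy_perm n (M : nat -> nat) : (forall c, c < n -> M c <= c) ->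
  exists s : 'S_n, (forall c : 'I_n, M c <= s c) /\
    (forall (c : 'I_n) v, M c <= v -> v < s c -> exists2 i : 'I_n, c < i & s i = v :> nat).
Proof.
move=> Mc; pose ms := [seq M c | c <- iota 0 n].
have sz : size ms = n by rewrite size_map size_iota.
have msE c : c < n -> nth 0 ms c = M c.
  by move=> cn; rewrite (nth_map 0) ?size_iota// nth_iota.
have bound (c : 'I_n) : nth 0 (greedy ms) c < n.
  have cn := ltn_ord c; rewrite nth_greedy ?sz// msE//.
  have [_ + _ _] := first_freeP (M c) (greedy (drop c.+1 ms)).
  by rewrite size_greedy size_drop sz; have := Mc c cn; lia.
pose f (c : 'I_n) := Ordinal (bound c).
have finj : injective f.
  move=> c c' /(congr1 val)/= /eqP; rewrite nth_uniq ?size_greedy ?sz ?uniq_greedy//.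
  by move/eqP/val_inj.
exists (perm finj); split=> [c|c v Mv]; rewrite permE /=.
  rewrite nth_greedy ?sz// msE//.
  by have [] := first_freeP (M c) (greedy (drop c.+1 ms)).
rewrite nth_greedy ?sz// msE// => vf.
have [_ _ _ /(_ v Mv vf)] := first_freeP (M c) (greedy (drop c.+1 ms)).
rewrite -drop_greedy => vin.
have szd : size (drop c.+1 (greedy ms)) = n - c.+1 by rewrite size_drop size_greedy sz.
have := index_mem v (drop c.+1 (greedy ms)); rewrite vin szd => idx.
have il : c.+1 + index v (drop c.+1 (greedy ms)) < n by lia.
exists (Ordinal il); first by rewrite /= leq_addr.
by rewrite permE /= -nth_drop nth_index.
Qed.

(** The greedy filling avoids 231: in a pattern at [i < j < k] the value [s i]
    lies between [M j] and [s j], hence was skipped at [j] because it was already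
    used at a later position, whereas it sits at [i]. *)
Lemma exists_low n (M : nat -> nat) : (forall c, c < n -> M c <= c) ->
  (forall c c', c <= c' -> c' < n -> M c <= M c') ->
  exists2 s : 'S_n, avoids231 s & forall c m, c < n -> low s c m = (M c <= m).
Proof.
move=> Mc Mmono; have [s [sM sfill]] := exists_greedy_perm Mc.
exists s.
  apply/avoids231P => i j k ij jk ki ikj.
  have [i' ji' E] := sfill j (s i)
    (leq_trans (leq_trans (Mmono j k (ltnW jk) (ltn_ord k)) (sM k)) (ltnW ki)) ikj.
  by have := perm_inj (val_inj E) => ii; rewrite ii in ji'; have := ltn_trans ij ji';
    rewrite ltnn.
move=> c m cn; apply/lowP/idP => [[i ci im]|Mm].
  by apply: leq_trans im; apply: leq_trans (sM i); apply: Mmono.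
have := sM (Ordinal cn); rewrite leq_eqVlt => /orP[/eqP E|lt].
  by exists (Ordinal cn) => //=; rewrite -E.
have [i ci si] := sfill (Ordinal cn) (M c) (leqnn _) lt.
by exists i; [exact: ltnW|rewrite si].
Qed.

Definition dyck (n : nat) (D : nat -> nat) : Prop :=
  [/\ D 0 = 0, D (2 * n) = 0 &
   forall k, k < 2 * n -> D k.+1 = (D k).+1 \/ D k = (D k.+1).+1].

Section Dyck.
Variables (n : nat) (D : nat -> nat).
Hypothesis dyckD : dyck n D.

Lemma dyck_le_id k : k <= 2 * n -> D k <= k.
Proof.
case: dyckD => D0 _ step; elim: k => [_|k IH kn]; first by rewrite D0.
by have := step k kn; have := IH (ltnW kn); lia.
Qed.

Lemma odd_dyck k : k <= 2 * n -> odd (D k) = odd k.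
Proof.
case: dyckD => D0 _ step; elim: k => [_|k IH kn]; first by rewrite D0.
by have := step k kn; have := IH (ltnW kn); lia.
Qed.

Lemma dyck_le_rev k : k <= 2 * n -> D k <= 2 * n - k.
Proof.
case: dyckD => _ D1 step.
suff main j : j <= 2 * n -> D (2 * n - j) <= j.
  by move=> kn; have := main (2 * n - k) (leq_subr _ _); rewrite subKn.
elim: j => [_|j IH jn]; first by rewrite subn0 D1.
have := step (2 * n - j.+1) ltac:(lia).
by rewrite (_ : (2 * n - j.+1).+1 = 2 * n - j); [have := IH (ltnW jn); lia|lia].
Qed.

Lemma dyck_lip k j : k + j <= 2 * n -> D (k + j) <= D k + j.
Proof.
case: dyckD => _ _ step; elim: j => [|j IH]; first by rewrite !addn0.
by rewrite addnS => kj; have := step _ kj; have := IH (ltnW kj); lia.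
Qed.

(** Read backwards, [low_height] prescribes a future minimum [M] for the given
    path; the unit steps make it a nondecreasing function below the diagonal, to
    which [exists_low] applies.  Conversely the heights of the right parity at
    [k] are exactly the numbers [c.+1 - m] with [m + c + 1 = k], so that the
    predicate [low] determines the path. *)
Lemma exists_height : exists2 s : 'S_n, avoids231 s &
  forall k, k <= 2 * n -> height s k = D k.
Proof.
case: dyckD => D0 D1 step.
pose L c m := c.+1 - m <= D (m + c + 1).
have Lex c : c < n -> exists m, L c m.
  by move=> cn; exists c; rewrite /L; have := @odd_dyck (c + c + 1); lia.
have Lup c m m' : c < n -> m <= m' -> m' <= c -> L c m -> L c m'.
  move=> cn mm mc; rewrite /L => Lm.
  elim: m' mm mc => [|m' IH]; first by rewrite leqn0 => /eqP m0; rewrite m0 in Lm.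
  rewrite leq_eqVlt => /orP[/eqP<-//|mm] mc.
  have := IH mm (ltnW mc); have := step (m' + c + 1) ltac:(lia).
  rewrite (_ : m'.+1 + c + 1 = (m' + c + 1).+1); lia.
have Ldiag c : c < n -> L c c.
  by move=> cn; rewrite /L; have := @odd_dyck (c + c + 1); lia.
pose M c := find (L c) (iota 0 c.+1).
have ME c m : c < n -> m <= c -> (M c <= m) = L c m.
  move=> cn mc; have hasL : has (L c) (iota 0 c.+1).
    by apply/hasP; exists c; [rewrite mem_iota ltnS leqnn|exact: Ldiag].
  apply/idP/idP => [Mm|Lm].
    apply: (Lup _ _ _ cn Mm mc); have := nth_find 0 hasL.
    by rewrite nth_iota ?add0n// -[X in _ < X](size_iota 0) -has_find.
  rewrite leqNgt; apply/negP => /(before_find 0).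
  by rewrite nth_iota ?add0n ?ltnS// Lm.
have Mc c : c < n -> M c <= c by move=> cn; rewrite ME// Ldiag.
have Mmono c c' : c <= c' -> c' < n -> M c <= M c'.
  move=> cc cn'; have cn := leq_ltn_trans cc cn'.
  have [lt|le] := ltnP c (M c'); first exact: leq_trans (Mc c cn) (ltnW lt).
  have := leqnn (M c'); rewrite {1}ME//; last exact: Mc.
  rewrite ME// /L => Lc'; have := @dyck_lip (M c' + c + 1) (c' - c).
  by rewrite (_ : M c' + c + 1 + (c' - c) = M c' + c' + 1); lia.
have [s av lowE] := exists_low Mc Mmono.
exists s => // k kn.
have heightE c m : m <= c -> c < n ->
    (c.+1 - m <= height s (m + c + 1)) = (c.+1 - m <= D (m + c + 1)).
  by move=> mc cn; rewrite -low_height// lowE// ME.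
have parh := odd_height s kn; have parD := odd_dyck kn.
have le1 := height_le_id s k; have le2 := height_le_rev s k.
have le3 := dyck_le_id kn; have le4 := dyck_le_rev kn.
have half d : 0 < d -> odd d = odd k -> d <= k -> d <= 2 * n - k ->
    (d <= height s k) = (d <= D k).
  move=> d0 par dk dnk.
  have := heightE ((k + d)./2.-1) ((k - d)./2) ltac:(lia) ltac:(lia).
  rewrite (_ : (k + d)./2.-1.+1 - (k - d)./2 = d); last lia.
  by rewrite (_ : (k - d)./2 + (k + d)./2.-1 + 1 = k); last lia.
apply/eqP; rewrite eqn_leq; apply/andP; split.
  by have [->//|h0] := posnP (height s k); rewrite -half.
by have [->//|D0'] := posnP (D k); rewrite half.
Qed.
End Dyck.

Import Order.TTheory GRing.Theory Num.Theory.
Import numFieldNormedType.Exports.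

Local Open Scope classical_set_scope.
Local Open Scope ring_scope.

(** * The space of excursions *)

Section Excursions.
Variable R : realType.
Implicit Types phi psi : excursion R.

Lemma excursionP phi : lip_excursions (excursion_fun phi).
Proof. by case: phi => f /= fP; exact/set_mem. Qed.

Lemma excursion_ge0 phi t : 0 <= phi t.
Proof.
have [_ ge0 _ _ out] := excursionP phi.
by case: (boolP (t \in `[0, 1])) => [/ge0|/out ->].
Qed.

Lemma excursion_out phi t : t \notin `[0, 1] -> phi t = 0.
Proof. by have [_ _ _ _ out] := excursionP phi; exact: out. Qed.

Lemma excursion_at0 phi : phi 0 = 0.
Proof. by have [] := excursionP phi. Qed.

Lemma excursion_at1 phi : phi 1 = 0.
Proof. by have [] := excursionP phi. Qed.

Lemma excursion_out0 phi t : t <= 0 -> phi t = 0.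
Proof.
move=> t0; have [->|nt] := eqVneq t 0; first exact: excursion_at0.
by apply: excursion_out; rewrite in_itv/= negb_and -ltNge lt_neqAle nt t0.
Qed.

Lemma excursion_out1 phi t : 1 <= t -> phi t = 0.
Proof.
move=> t1; have [->|nt] := eqVneq t 1; first exact: excursion_at1.
apply: excursion_out; rewrite in_itv/= negb_and -!ltNge [1 < t]lt_neqAle.
by rewrite eq_sym nt t1 orbT.
Qed.

Lemma excursion_incr phi x y : x <= y -> `|phi y - phi x| <= y - x.
Proof.
have lip u v : 0 <= u -> u <= v -> v <= 1 -> `|phi v - phi u| <= v - u.
  have [lip _ _ _ _] := excursionP phi.
  move=> u0 uv v1; have := lip (v, u) => /=; rewrite mul1r.
  rewrite (@ger0_norm _ (v - u)) ?subr_ge0//; apply.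
  by split; rewrite /= in_itv/=; apply/andP; split; lra.
move=> xy; have [y0|y0] := leP y 0.
  rewrite !excursion_out0 ?subrr ?normr0 ?subr_ge0//.
  exact: le_trans xy y0.
have [x1|x1] := leP 1 x.
  rewrite !excursion_out1 ?subrr ?normr0 ?subr_ge0//.
  exact: le_trans x1 xy.
have -> : phi x = phi (Num.max x 0).
  by case: (leP x 0) => // x0; rewrite !excursion_out0.
have -> : phi y = phi (Num.min y 1).
  by case: (leP y 1) => // /ltW y1; rewrite !excursion_out1.
apply: (le_trans (lip _ _ _ _ _)).
- by rewrite le_max lexx orbT.
- by rewrite ge_max !le_min xy ltW//= ltW//= ler01.
- by rewrite ge_min lexx orbT.
- rewrite lerB//; first by rewrite ge_min lexx.
  by rewrite le_max lexx.
Qed.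

Lemma excursion_lip phi x y : `|phi x - phi y| <= `|x - y|.
Proof.
have [xy|/ltW xy] := leP x y.
  by rewrite distrC [leRHS]distrC [leRHS]ger0_norm ?subr_ge0// excursion_incr.
by rewrite [leRHS]ger0_norm ?subr_ge0// excursion_incr.
Qed.

Lemma excursion_continuous phi : continuous (phi : R -> R).
Proof.
move=> x; apply/cvgrPdist_lt => e e0; near=> y.
apply: le_lt_trans (excursion_lip phi x y) _.
by near: y; exact: (@cvgr_dist_lt _ R^o).
Unshelve. all: by end_near. Qed.

Lemma excursion_le_id phi t : 0 <= t -> phi t <= t.
Proof.
move=> t0; have := excursion_incr phi t0; rewrite excursion_at0 !subr0.
exact: le_trans (ler_norm _).
Qed.

Lemma excursion_le_onem phi t : t <= 1 -> phi t <= 1 - t.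
Proof.
move=> t0; have := excursion_incr phi t0; rewrite excursion_at1 sub0r normrN.
exact: le_trans (ler_norm _).
Qed.

Lemma excursion_ext phi psi : (forall t, 0 <= t <= 1 -> phi t = psi t) ->
  phi = psi.
Proof.
move=> e; apply: val_inj; apply/funext => t /=; rewrite -!/(excursion_fun _).
case: (boolP (t \in `[0, 1])) => [|t01]; first by rewrite in_itv/= => /e.
by rewrite -[LHS]/(phi t) -[RHS]/(psi t) !excursion_out.
Qed.

Section Make.
Variable f : R -> R.
Hypothesis flip : forall x y, 0 <= x -> x <= y -> y <= 1 -> `|f y - f x| <= y - x.
Hypothesis f_ge0 : forall t, 0 <= t <= 1 -> 0 <= f t.
Hypotheses (f0 : f 0 = 0) (f1 : f 1 = 0).

Definition cut_to_unit t : R := if t \in `[0, 1] then f t else 0.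

Lemma cut_to_unit_lip_excursions : cut_to_unit \in @lip_excursions R.
Proof.
apply/mem_set; split.
- move=> [x y] /= [x01 y01]; rewrite /cut_to_unit x01 y01 mul1r.
  move: x01 y01; rewrite !in_itv/= => /andP[x0 x1] /andP[y0 y1].
  have [xy|/ltW yx] := leP x y.
    by rewrite distrC [leRHS]distrC [leRHS]ger0_norm ?subr_ge0// flip.
  by rewrite [leRHS]ger0_norm ?subr_ge0// flip.
- by move=> t t01; rewrite /cut_to_unit t01 f_ge0//; rewrite in_itv/= in t01.
- by rewrite /cut_to_unit in_itv/= lexx ler01.
- by rewrite /cut_to_unit in_itv/= lexx ler01.
- by move=> t /negbTE; rewrite /cut_to_unit => ->.
Qed.

Definition make_excursion : excursion R :=
  exist (fun h => h \in @lip_excursions R) _ cut_to_unit_lip_excursions.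

Lemma make_excursionE t : 0 <= t <= 1 -> make_excursion t = f t.
Proof.
by move=> t01; rewrite -[LHS]/(cut_to_unit t) /cut_to_unit in_itv/= t01.
Qed.
End Make.

Lemma excursion_nbhsP phi (V : set (excursion R)) :
  nbhs phi V <-> exists2 e, 0 < e &
    forall psi, (forall t, 0 <= t <= 1 -> `|phi t - psi t| < e) -> V psi.
Proof.
split.
- case=> _ [] [W oW <-] /= Wphi WV.
  have /(uniform_nbhs (set_val phi)) : nbhs (set_val phi) W.
    exact: open_nbhs_nbhs.
  case=> E [/= entE EW].
  move: entE; rewrite -entourage_ballE => -[e e0 eE].
  exists e => // psi close; apply: WV; apply: EW => t t01.
  by apply: eE => /=; apply: close; move: t01; rewrite /= in_itv.
- case=> e e0 eV; rewrite nbhsE/=.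
  have : nbhs (set_val phi : {uniform` `[0, 1]%classic -> R})
     [set h | forall t, `[0, 1]%classic t -> `|set_val phi t - h t| < e].
    apply/uniform_nbhs; exists [set xy | `|xy.1 - xy.2| < e]; split => //=.
    by rewrite -entourage_ballE; exists e.
  rewrite nbhsE => -[U [oU Uphi] Ue].
  exists (set_val @^-1` U); first by split=> //; exists U.
  move=> psi /= /Ue /= close; apply: eV => t t01.
  by apply: close; rewrite /= in_itv.
Qed.

(** The theorem of Arzela and Ascoli.  An ultrafilter of excursions converges at
    every point, as the values lie in a segment; the limit inherits the Lipschitz
    bound, and then closeness on a finite grid is closeness everywhere. *)
Lemma excursion_compact : compact [set: excursion R].
Proof.
rewrite compact_ultra => F UF _.
have Fev t : exists p : R, (fun psi => psi t) @ F --> p.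
  have FB : F [set psi : excursion R | `[0, 1]%classic (psi t)].
    apply: filterS filterT => psi _ /=; rewrite in_itv/= excursion_ge0/=.
    have [t0|/ltW t0] := leP t 0; first by rewrite excursion_out0// ler01.
    have [t1|/ltW t1] := leP t 1; last by rewrite excursion_out1// ler01.
    by apply: le_trans (excursion_le_id _ t0) _.
  have [p [_ clp]] := @segment_compact R 0 1 ((fun psi => psi t) @ F) _ FB.
  exists p => V pV; have [//|FVc] := in_ultra_setVsetC
    ((fun psi : excursion R => psi t) @^-1` V) UF.
  by have [y [nVy Vy]] := clp (~` V) V FVc pV.
have [f fP] := choice Fev.
have flip x y : 0 <= x -> x <= y -> y <= 1 -> `|f y - f x| <= y - x.
  move=> x0 xy y1.
  have c : (fun psi => `|psi y - psi x|) @ F --> `|f y - f x|.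
    by apply: (@cvg_norm _ R^o); apply: (@cvgB _ R^o); exact: fP.
  rewrite -(cvg_lim _ c)//; apply: limr_le; first by apply/cvg_ex; eexists; exact: c.
  by apply: nearW => psi; exact: (excursion_incr psi xy).
have f_ge0 t : 0 <= t <= 1 -> 0 <= f t.
  move=> _; rewrite -(cvg_lim _ (fP t))//; apply: limr_ge.
    by apply/cvg_ex; eexists; exact: fP.
  by apply: nearW => psi; exact: excursion_ge0.
have f0 : f 0 = 0.
  rewrite -(cvg_lim _ (fP 0))//; apply/cvg_lim => //.
  by under eq_fun do rewrite excursion_at0; exact: cvg_cst.
have f1 : f 1 = 0.
  rewrite -(cvg_lim _ (fP 1))//; apply/cvg_lim => //.
  by under eq_fun do rewrite excursion_at1; exact: cvg_cst.
exists (make_excursion flip f_ge0 f0 f1); split=> // V.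
move=> /excursion_nbhsP[e e0 eV].
have [N Ne] : exists N : nat, N.+1%:R^-1 < e / 3.
  have := near_infty_natSinv_lt (PosNum (divr_gt0 e0 (ltr0n _ 3))).
  by case=> N _ /(_ N (leqnn N)) /= H; exists N.
have : F [set psi : excursion R | forall j : 'I_N.+2,
    `|f (j%:R / N.+1%:R) - psi (j%:R / N.+1%:R)| < e / 3].
  apply: filter_forall => j /=.
  have /cvgrPdist_lt := fP (j%:R / N.+1%:R); apply.
  by rewrite divr_gt0.
apply: filterS => psi close; apply: eV => t /andP[t0 t1].
rewrite make_excursionE ?t0//.
pose j := Num.truncn (t * N.+1%:R).
have N0 : 0 < N.+1%:R :> R by rewrite ltr0n.
have /andP[jt tj] : j%:R <= t * N.+1%:R < j.+1%:R.
  by apply: truncn_itv; rewrite mulr_ge0// ltW.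
have jN : (j < N.+2)%N.
  rewrite ltnS -(ler_nat R); apply: le_trans jt _.
  by rewrite ler_piMl// ltW.
have jt' : j%:R / N.+1%:R <= t by rewrite ler_pdivrMr.
have tj' : t - j%:R / N.+1%:R < e / 3.
  apply: lt_trans Ne; rewrite ltrBlDl -[X in _ + X]mul1r -mulrDl.
  by rewrite ltr_pdivlMr// natr1.
have c := close (Ordinal jN); rewrite /= in c.
have u0 : 0 <= j%:R / N.+1%:R :> R by rewrite divr_ge0// ltW.
have c1 := flip _ _ u0 jt' t1.
have c2 := excursion_incr psi jt'.
have close3 (a b u v z : R) : `|a - b| < e / 3 -> `|u - a| <= z ->
    `|v - b| <= z -> z < e / 3 -> `|u - v| < e.
  by rewrite !ltr_norml !ler_norml => /andP[? ?] /andP[? ?] /andP[? ?] ?; lra.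
exact: close3 c c1 c2 tj'.
Qed.

End Excursions.

(** * Large deviations from local estimates on a compact space *)

Section LimEsup.
Variable R : realType.
Local Open Scope ereal_scope.
Implicit Type u : (\bar R)^nat.

Lemma limn_esup_le u c : (\forall n \near \oo, u n <= c) -> limn_esup u <= c.
Proof.
move=> uc; apply: ge_ereal_inf.
exists (ereal_sup (u @` [set n | u n <= c])); first by exists [set n | u n <= c].
by apply: ub_ereal_sup => _ [n /= unc <-].
Qed.

Lemma limn_einf_ge u c : (\forall n \near \oo, c <= u n) -> c <= limn_einf u.
Proof.
move=> uc; rewrite /limn_einf leeNr; apply: limn_esup_le.
by apply: filterS uc => n cu; rewrite leeN2.
Qed.

Lemma le_of_lt_le (x y : \bar R) :
  (forall r, r%:E < x -> r%:E <= y) -> x <= y.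
Proof.
move=> xy; rewrite leNgt; apply/negP => yx.
move: x y xy yx => [x| |] [y| |] //= xy; rewrite ?ltxx//.
- rewrite lte_fin => yx; have := xy ((x + y) / 2)%R; rewrite lte_fin lee_fin.
  by move=> /(_ ltac:(lra)); lra.
- by move=> _; have := xy (x - 1)%R; rewrite lte_fin => /(_ ltac:(lra)).
- by move=> _; have := xy (y + 1)%R; rewrite ltry lee_fin => /(_ isT); lra.
- by move=> _; have := xy 0%R; rewrite ltry => /(_ isT).
Qed.

End LimEsup.

(** A property of sets that passes to subsets and finite unions holds on a
    compact set as soon as it holds near each of its points.  If it failed on
    [K], the sets with good complement in [K] would form a proper filter without
    cluster point in [K]. *)
Lemma compact_local_to_global (T : topologicalType) (K : set T)
    (good : set (set T)) : compact K ->
  (forall V V', V `<=` V' -> good V' -> good V) ->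
  good set0 -> (forall V V', good V -> good V' -> good (V `|` V')) ->
  (forall x, K x -> exists2 V, nbhs x V & good V) -> good K.
Proof.
move=> cK goodS good0 goodU goodloc; apply: contrapT => badK.
pose F : set_system T := [set B | good (K `\` B)].
have FF : ProperFilter F.
  split; first by rewrite /F/= setD0.
  split.
  - by rewrite /F/= setDT.
  - by move=> P Q; rewrite /F/= setDIr; exact: goodU.
  - by move=> P Q PQ; apply: goodS => x [Kx nQ]; split=> // /PQ.
have FK : F K by rewrite /F/= setDv.
have [x [Kx clx]] := cK F FF FK.
have [V xV gV] := goodloc _ Kx.
have FV : F (~` V) by apply: goodS gV => y [_ /contrapT].
by have [y [nVy Vy]] := clx _ _ FV xV.
Qed.

(** Here [w n] is an unnormalised mass and [A] an energy such that the mass of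
    small neighbourhoods of [x] decays like the exponential of [- n * A x].
    Normalisation by the total mass subtracts the infimum of [A]. *)
Section AbstractLDP.
Variables (R : realType) (T : topologicalType).
Hypothesis cptT : compact [set: T].
Variables (w : nat -> set T -> R) (A : T -> R).
Hypothesis w0 : forall n, w n set0 = 0.
Hypothesis wS : forall n V V', V `<=` V' -> w n V <= w n V'.
Hypothesis wU : forall n V V', w n (V `|` V') <= w n V + w n V'.
Hypothesis upper : forall x e, 0 < e -> exists2 V, nbhs x V &
  \forall n \near \oo, w n V <= expR (n%:R * (- A x + e)).
Hypothesis lower : forall x V e, nbhs x V -> 0 < e ->
  \forall n \near \oo, expR (n%:R * (- A x - e)) <= w n V.

(** Semicontinuity of the energy costs nothing: if [y] is close to [x], the same
    neighbourhood is covered by the upper estimate at [x] and by the lower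
    estimate at [y]. *)
Lemma local_lower_bound x e : 0 < e ->
  exists2 V, nbhs x V & forall y, V y -> A x - e < A y.
Proof.
move=> e0; have e3 : 0 < e / 3 by rewrite divr_gt0.
have [V xV Vle] := upper x e3.
exists V^°; first exact: nbhs_interior.
move=> y yV; have yle := lower yV e3.
near \oo => n.
have : expR (n%:R * (- A y - e / 3)) <= expR (n%:R * (- A x + e / 3)).
  apply: (@le_trans _ _ (w n V)).
    by near: n.
  by near: n.
have n0 : 0 < n%:R :> R by rewrite ltr0n; near: n; exact: nbhs_infty_gt.
rewrite ler_expR ler_pM2l//; lra.
Unshelve. all: by end_near. Qed.

Lemma energy_has_lbound : has_lbound (range A).
Proof.
suff [M MA] : exists M, forall y, [set: T] y -> M <= A y.
  by exists M => _ [y _ <-]; exact: MA.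
apply: (@compact_local_to_global _ _
  [set V : set T | exists M, forall y, V y -> M <= A y] cptT).
- by move=> V V' VV' [M MA]; exists M => y /VV'; exact: MA.
- by exists 0.
- move=> V V' [M MA] [M' MA']; exists (Num.min M M') => y [/MA|/MA'] ?.
    by rewrite ge_min; apply/orP; left.
  by rewrite ge_min; apply/orP; right.
- move=> x _; have [V xV VA] := local_lower_bound x ltr01.
  by exists V => //; exists (A x - 1) => y /VA/ltW.
Qed.

Hypothesis T0 : [set: T] !=set0.

Lemma energy_has_inf : has_inf (range A).
Proof.
split; last exact: energy_has_lbound.
by have [x _] := T0; exists (A x); exists x.
Qed.

Local Notation i := (inf (range A)).

Lemma energy_ge_inf x : i <= A x.
Proof. by apply: ge_inf; [exact: energy_has_lbound|exists x]. Qed.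

Lemma closed_upper_bound F m e : closed F -> 0 < e ->
  (forall x, F x -> m <= A x) ->
  \forall n \near \oo, w n F <= expR (n%:R * (- m + e)).
Proof.
move=> cF e0 mF.
have cptF : compact F by apply: (subclosed_compact cF cptT).
have e2 : 0 < e / 2 by rewrite divr_gt0.
(* A finite union multiplies the bound by a constant [K], which the second half
   of [e] absorbs. *)
pose good : set (set T) := [set V | exists K : R,
  \forall n \near \oo, w n (V `&` F) <= K * expR (n%:R * (- m + e / 2))].
suff [K] : good F.
  rewrite setIid => FK; near=> n.
  apply: (@le_trans _ _ (K * expR (n%:R * (- m + e / 2)))); first by near: n.
  have -> : n%:R * (- m + e) = n%:R * (e / 2) + n%:R * (- m + e / 2) by field.
  rewrite expRD ler_pM2r ?expR_gt0//.
  apply: le_trans (expR_ge1Dx _).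
  have : 2 / e * K <= n%:R by near: n; exact: nbhs_infty_ger.
  by rewrite mulrAC ler_pdivrMr//; lra.
apply: (compact_local_to_global cptF).
- move=> V V' VV' [K gV']; exists K; apply: filterS gV' => n.
  by apply: le_trans; apply: wS; exact: setSI.
- by exists 0; apply: nearW => n; rewrite set0I w0 mul0r.
- move=> V V' [K gV] [K' gV']; exists (K + K').
  near=> n; rewrite setIUl; apply: le_trans (wU _ _ _) _.
  by rewrite mulrDl lerD//; near: n.
- move=> x Fx; have [V xV Vle] := upper x e2.
  exists V => //; exists 1; apply: filterS Vle => n.
  rewrite mul1r => Vle; apply: le_trans (le_trans (wS _ (@subIsetl _ _ _)) Vle) _.
  by rewrite ler_expR ler_wpM2l// lerD2r lerN2 mF.
Unshelve. all: by end_near. Qed.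

Lemma total_mass_ge e : 0 < e ->
  \forall n \near \oo, expR (n%:R * (- i - e)) <= w n setT.
Proof.
move=> e0; have e2 : 0 < e / 2 by rewrite divr_gt0.
have [_ [x _ <-] xi] := inf_adherent e2 energy_has_inf.
have xT : nbhs x [set: T] by exact: filterT.
apply: filterS (lower xT e2) => n; apply: le_trans.
by rewrite ler_expR ler_wpM2l//; lra.
Qed.

Lemma total_mass_le e : 0 < e ->
  \forall n \near \oo, w n setT <= expR (n%:R * (- i + e)).
Proof.
by move=> e0; apply: closed_upper_bound => // x _; exact: energy_ge_inf.
Qed.

Variable p : nat -> set T -> R.
Hypothesis pE : forall n V, (0 < n)%N -> p n V = w n V / w n setT.

Local Notation rate := (fun x => (A x - i)%:E).
Local Notation logp V := (fun n => (n%:R^-1%:E * lne (p n V)%:E)%E).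

Lemma scaled_log_le (n : nat) (c r : R) : (0 < n)%N -> c <= expR (n%:R * r) ->
  (n%:R^-1%:E * lne c%:E <= r%:E)%E.
Proof.
move=> n0 cr; have n0' : 0 < n%:R :> R by rewrite ltr0n.
have [c0|c0] := leP c 0.
  by rewrite le0_lneNy ?lee_fin// gt0_muleNy ?leNye// lte_fin invr_gt0.
rewrite lne_EFin// -EFinM lee_fin mulrC ler_pdivrMr// mulrC.
by rewrite -(expRK (n%:R * r)) ler_ln// posrE expR_gt0.
Qed.

Lemma scaled_log_ge (n : nat) (c r : R) : (0 < n)%N -> expR (n%:R * r) <= c ->
  (r%:E <= n%:R^-1%:E * lne c%:E)%E.
Proof.
move=> n0 cr; have n0' : 0 < n%:R :> R by rewrite ltr0n.
have c0 : 0 < c by apply: lt_le_trans cr; exact: expR_gt0.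
rewrite lne_EFin// -EFinM lee_fin mulrC ler_pdivlMr// mulrC.
by rewrite -(expRK (n%:R * r)) ler_ln// posrE expR_gt0.
Qed.

Lemma ldp_upper F : closed F ->
  (limn_esup (logp F) <= - ereal_inf (rate @` F))%E.
Proof.
move=> cF; rewrite leeNr; apply: le_of_lt_le => r rF; rewrite leeNr.
apply/lee_addgt0Pr => e e0; rewrite -EFinN -EFinD.
have e2 : 0 < e / 2 by rewrite divr_gt0.
have mF x : F x -> i + r <= A x.
  move=> Fx; have : (r%:E <= (A x - i)%:E)%E.
    by apply: (le_trans (ltW rF)); apply: ereal_inf_lbound; exists x.
  by rewrite lee_fin; lra.
apply: limn_esup_le; near=> n.
have n0 : (0 < n)%N by near: n; exact: nbhs_infty_gt.
apply: scaled_log_le => //; rewrite pE//.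
have tot : expR (n%:R * (- i - e / 2)) <= w n setT.
  by near: n; exact: total_mass_ge.
rewrite ler_pdivrMr ?(lt_le_trans (expR_gt0 _) tot)//.
apply: (@le_trans _ _ (expR (n%:R * (- r + e)) * expR (n%:R * (- i - e / 2)))).
  rewrite -expRD -mulrDr.
  have -> : - r + e + (- i - e / 2) = - (i + r) + e / 2 by field.
  by near: n; exact: closed_upper_bound.
by rewrite ler_pM2l// expR_gt0.
Unshelve. all: by end_near. Qed.

Lemma ldp_lower U : open U ->
  (- ereal_inf (rate @` U) <= limn_einf (logp U))%E.
Proof.
move=> oU; rewrite leeNl; apply: le_ereal_inf_tmp => _ [x Ux <-]; rewrite leeNl.
apply/lee_addgt0Pr => e e0; rewrite -EFinN -leeBlDr// -EFinB.
have e2 : 0 < e / 2 by rewrite divr_gt0.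
have xU : nbhs x U by exact: open_nbhs_nbhs.
apply: limn_einf_ge; near=> n.
have n0 : (0 < n)%N by near: n; exact: nbhs_infty_gt.
apply: scaled_log_ge => //; rewrite pE//.
have tot0 : 0 < w n setT.
  apply: lt_le_trans (expR_gt0 (n%:R * (- i - e))) _.
  by near: n; exact: total_mass_ge.
rewrite ler_pdivlMr//.
apply: (@le_trans _ _ (expR (n%:R * (- (A x - i) - e)) * expR (n%:R * (- i + e / 2)))).
  rewrite ler_pM2l ?expR_gt0//.
  by near: n; exact: total_mass_le.
rewrite -expRD -mulrDr.
have -> : - (A x - i) - e + (- i + e / 2) = - A x - e / 2 by field.
by near: n; exact: lower.
Unshelve. all: by end_near. Qed.

Lemma rate_ge0 x : (0 <= rate x)%E.
Proof. by rewrite lee_fin subr_ge0 energy_ge_inf. Qed.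

Lemma rate_lower_semicontinuous : lower_semicontinuous rate.
Proof.
move=> x a; rewrite lte_fin => ax.
have e0 : 0 < A x - i - a by rewrite subr_gt0.
have [V xV VA] := local_lower_bound x e0.
by exists V => // y /VA; rewrite lte_fin; lra.
Qed.

End AbstractLDP.

(** * Almost everywhere differentiability *)

Section NullSets.
Local Open Scope ereal_scope.
Context d (T : measurableType d) (R : realType).
Variable mu : {measure set T -> \bar R}.
Import HBNNSimple.

(** The integral of a nonnegative function is a supremum over simple functions
    below it, and a simple function may be set to zero on a null set.  Hence null
    sets can be neglected without measurability of [f], which spares a separate
    argument for the derivative of an excursion. *)
Lemma sup_sintegral_null (N : set T) (f g : T -> \bar R) :
  measurable N -> mu N = 0 -> (forall x, 0 <= g x) ->
  (forall x, ~ N x -> f x = g x) ->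
  ereal_sup [set sintegral mu h | h in
     [set h : {nnsfun T >-> R} | forall x, (h x)%:E <= f x]] <=
  ereal_sup [set sintegral mu h | h in
     [set h : {nnsfun T >-> R} | forall x, (h x)%:E <= g x]].
Proof.
move=> mN N0 g0 fg; apply: ub_ereal_sup => _ [h hf <-].
have mNC : measurable (~` N) by exact: measurableC.
apply: le_ereal_sup_tmp; exists (sintegral mu (proj_nnsfun h mNC)).
  exists (proj_nnsfun h mNC) => // x /=.
  rewrite mindicE; case: (boolP (x \in ~` N)) => [|_]; last by rewrite mulr0.
  by rewrite inE => Nx; rewrite mulr1 -fg.
have -> : sintegral mu h = \int[mu]_(x in setT) (h x)%:E.
  by rewrite integral_nnsfun// patch_setT.
have -> : sintegral mu (proj_nnsfun h mNC) = \int[mu]_(x in setT) (proj_nnsfun h mNC x)%:E.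
  by rewrite integral_nnsfun// patch_setT.
rewrite le_eqVlt; apply/orP; left; apply/eqP; apply: ge0_ae_eq_integral => //.
- by apply/measurable_EFinP.
- by apply/measurable_EFinP.
- by move=> x _; rewrite lee_fin; exact: fun_ge0.
- by move=> x _; rewrite lee_fin; exact: fun_ge0.
exists N; split => // x /=; apply: contra_notP => Nx _.
by rewrite mindicE mem_set// mulr1.
Qed.

Lemma integral_eq_off_null (D N : set T) (f g : T -> \bar R) :
  measurable N -> mu N = 0 -> (forall x, D x -> ~ N x -> f x = g x) ->
  \int[mu]_(x in D) f x = \int[mu]_(x in D) g x.
Proof.
move=> mN N0 fg; rewrite /integral.
have fgD x : ~ N x -> (f \_ D) x = (g \_ D) x.
  by rewrite !patchE; case: ifPn => // /set_mem Dx Nx; exact: fg.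
by congr (_ - _); apply/eqP; rewrite eq_le; apply/andP; split;
  apply: (sup_sintegral_null mN N0) => x; rewrite ?funepos_ge0 ?funeneg_ge0//;
  move=> Nx; rewrite ?(funeposE, funenegE) fgD.
Qed.

End NullSets.

Section Derivative.
Variable R : realType.
Implicit Type phi : excursion R.
Local Notation lambda := (@lebesgue_measure R).

Section OneExcursion.
Variable phi : excursion R.

(** An excursion is not monotone, but the sum and the difference of the identity
    and an excursion are, and they define Stieltjes measures. *)
Definition tilt (e : R) (t : R) : R := t + e * phi t.

Lemma tilt_nondecreasing e : `|e| <= 1 -> nondecreasing (tilt e).
Proof.
move=> e1 x y xy; rewrite /tilt -subr_ge0.
have -> : y + e * phi y - (x + e * phi x) = (y - x) + e * (phi y - phi x) by ring.
have : `|e * (phi y - phi x)| <= y - x.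
  rewrite normrM; apply: le_trans (excursion_incr phi xy).
  by rewrite ler_piMl.
by rewrite ler_norml => /andP[? _]; lra.
Qed.

Lemma tilt_right_continuous e : right_continuous (tilt e).
Proof.
apply: right_continuousW => x; apply: cvgD; first exact: cvg_id.
by apply: cvgM; [exact: cvg_cst|exact: excursion_continuous].
Qed.

Definition tilt_up := tilt 1.
Definition tilt_down := tilt (-1).

Fact tilt_up_nondecreasing : nondecreasing tilt_up.
Proof. by apply: tilt_nondecreasing; rewrite normr1. Qed.
Fact tilt_down_nondecreasing : nondecreasing tilt_down.
Proof. by apply: tilt_nondecreasing; rewrite normrN1. Qed.

HB.instance Definition _ := isCumulative.Build R _ R tilt_up
  tilt_up_nondecreasing (@tilt_right_continuous 1).
HB.instance Definition _ := isCumulative.Build R _ R tilt_down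
  tilt_down_nondecreasing (@tilt_right_continuous (-1)).

Local Notation up := (lebesgue_stieltjes_measure tilt_up).
Local Notation down := (lebesgue_stieltjes_measure tilt_down).

Lemma stieltjes_itv (f : cumulative R R) (a b : R) : a <= b ->
  lebesgue_stieltjes_measure f `]a, b]%classic = (f b - f a)%:E.
Proof.
move=> ab; rewrite /lebesgue_stieltjes_measure /measure_extension/=.
rewrite measurable_mu_extE/=; last exact: is_ocitv.
by rewrite wlength_itv_bnd.
Qed.

(** The excursion cancels between [tilt_up] and [tilt_down].  Consequently the
    Stieltjes measure of [tilt_up] is dominated by Lebesgue measure. *)
Lemma lebesgue_mean_stieltjes A : measurable A ->
  lambda A = mscale (2^-1)%:nng (measure_add up down) A.
Proof.
apply: lebesgue_measure_unique => X /ocitvP[->|[[a b] /= ab ->]].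
  by rewrite !measure0.
rewrite /mscale -[X in (_ * X)%E]/(measure_add up down _) measure_addE.
have E (f : cumulative R R) := stieltjes_itv f (ltW ab).
rewrite /lebesgue_measure (E idfun).
transitivity (2^-1%:E * ((tilt_up b - tilt_up a)%:E + (tilt_down b - tilt_down a)%:E))%E;
  last by congr (_ * (_ + _))%E; rewrite -E.
rewrite -EFinD -EFinM; congr EFin.
by rewrite /tilt_up /tilt_down /tilt /=; field.
Qed.

Lemma up_null A : measurable A -> lambda A = 0%E -> up A = 0%E.
Proof.
move=> mA; rewrite lebesgue_mean_stieltjes// /mscale.
rewrite -[X in (_ * X)%E]/(measure_add up down _) measure_addE.
move/eqP; rewrite mule_eq0 eqe invr_eq0 pnatr_eq0/=.
by rewrite padde_eq0// => /andP[/eqP].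
Qed.

Lemma up_unit_lty : (up `]0%R, 1%R]%classic < +oo)%E.
Proof. by rewrite stieltjes_itv// ltry. Qed.

Lemma excursion_density : exists h : R -> R,
  lambda.-integrable setT (EFin \o h) /\
  forall x, 0 <= x <= 1 -> \int[lambda]_(t in `]0, x]) h t = x + phi x.
Proof.
pose nu : {finite_measure set (measurableTypeR R) -> \bar R} :=
  @mfrestr _ (measurableTypeR R) R _ _ (measurable_itv `]0%R, 1%R]) up_unit_lty.
have dom : nu `<< lambda.
  move=> A nullA B mB BA; apply/eqP; rewrite eq_le measure_ge0 andbT.
  rewrite -(up_null mB (nullA B mB BA)) /nu/= /mfrestr /mrestr.
  by apply: le_measure; rewrite ?inE//; exact: measurableI.
have [h [h0 hfin inth hE]] := radon_nikodym_sigma_finite dom.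
have Eh : EFin \o (fine \o h) = h by apply/funext => t /=; rewrite fineK.
exists (fine \o h); split; first by rewrite Eh.
move=> x /andP[x0 x1]; rewrite /Rintegral.
rewrite -[X in fine X]/(\int[lambda]_(t in `]0%R, x]) ((EFin \o (fine \o h)) t))%E Eh -hE//.
rewrite /nu/= /mfrestr /mrestr setIidl.
  by rewrite stieltjes_itv//= /tilt_up /tilt excursion_at0; ring.
by move=> t /=; rewrite !in_itv/= => /andP[-> /le_trans]; exact.
Qed.

(** An excursion is the integral of a Radon-Nikodym density up to a linear
    function; the Lebesgue differentiation theorem applies to the density. *)
Lemma excursion_ae_derivable : exists2 h : R -> R, measurable_fun setT h &
  {ae lambda, forall x, 0 < x < 1 ->
    derivable (phi : R -> R) x 1 /\ derive1 phi x = h x}.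
Proof.
have [h [inth hE]] := excursion_density.
have mh : measurable_fun setT h by apply/measurable_EFinP; exact: measurable_int inth.
exists (fun x => h x - 1); first exact: measurable_funB.
have loch : locally_integrable setT h.
  by apply: open_integrable_locally => //; exact: openT.
have inth' y : lambda.-integrable [set` Interval (BRight 0) (BRight y)] (EFin \o h).
  exact: integrableS inth.
have := @FTC1 R h (BRight 0) inth' loch.
apply: filterS; first exact: (ae_filter_ringOfSetsType lambda).
move=> x FTC /andP[x0 x1].
have [Fder FE] := FTC ltac:(by rewrite lte_fin).
set F := (fun y => _) in Fder FE.
have near_eq : {near x, F =1 (fun y => y + phi y)}.
  near=> y; rewrite /F hE//; apply/andP; split; apply: ltW; near: y.
    exact: lt_nbhsr.
  exact: lt_nbhsl.
have dF : is_derive x 1 F (h x).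
  by apply: DeriveDef; [exact: Fder|rewrite -derive1E].
have did : is_derive x 1 (fun y => y + phi y) (h x).
  exact: near_eq_is_derive near_eq dF.
have dphi : is_derive x 1 (phi : R -> R) (h x - 1).
  have -> : (phi : R -> R) = (fun y => y + phi y) - id.
    by apply/funext => y; rewrite !fctE addrAC subrr add0r.
  exact: is_deriveB.
by split; [case: dphi|rewrite derive1E; apply: derive_val].
Unshelve. all: by end_near. Qed.

End OneExcursion.
End Derivative.

(** * Convergence of block energies *)

Section Entropy.
Variable R : realType.
Implicit Types x y : R.

Lemma ln_le_subr1 x : 0 < x -> ln x <= x - 1.
Proof.
by move=> x0; rewrite -[X in ln X](subrKC 1) le_ln1Dx// ltrBrDl subrr.
Qed.

Lemma xlnx_le x : 0 <= x -> x * ln x <= x * (x - 1).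
Proof.
rewrite le_eqVlt => /orP[/eqP<-|x0]; first by rewrite !mul0r.
by rewrite ler_pM2l// ln_le_subr1.
Qed.

(** The tangent of the convex function [x * ln x] at [a]. *)
Lemma xlnx_ge a x : 0 < a -> 0 <= x -> x * (ln a + 1) - a <= x * ln x.
Proof.
move=> a0; rewrite le_eqVlt => /orP[/eqP<-|x0].
  by rewrite !mul0r sub0r oppr_le0 ltW.
have := ln_le_subr1 (divr_gt0 a0 x0).
rewrite ln_div ?posrE// -(ler_pM2l x0) mulrBr mulrBr mulrCA mulfV ?gt_eqF//; lra.
Qed.

(** Since [ln] vanishes on nonpositive numbers, only the point zero matters; there
    the tangent at [e / 2] bounds the function from below. *)
Lemma continuous_xlnx : continuous (fun x => x * ln x).
Proof.
move=> x; have [x0|x0|->] := ltgtP x 0.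
- have : {near x, (fun=> 0) =1 (fun x => x * ln x)}.
    near=> z; rewrite ln0 ?mulr0//; apply: ltW; near: z; exact: lt_nbhsl.
  move=> E; apply: (cvg_trans (near_eq_cvg E)).
  by rewrite ln0 ?mulr0 ?ltW//; exact: cvg_cst.
- by apply: cvgM; [exact: cvg_id|exact: continuous_ln].
apply/(@cvgrPdist_lt _ R^o) => e e0; rewrite mul0r.
have a0 : 0 < e / 2 by rewrite divr_gt0.
pose K := `|ln (e / 2)| + 1.
have K0 : 0 < K by rewrite ltr_wpDl.
near=> z; rewrite sub0r normrN.
have [z0|z0] := leP z 0; first by rewrite ln0// mulr0 normr0.
have zK : z * K < e / 2.
  by rewrite -ltr_pdivlMr//; near: z; apply: lt_nbhsl; rewrite divr_gt0.
have z1 : z < 1 by near: z; apply: lt_nbhsl.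
have lb := xlnx_ge a0 (ltW z0).
have ub : z * ln z <= 0 by rewrite pmulr_rle0// ln_le0// ltW.
have : z * (- K) <= z * (ln (e / 2) + 1).
  rewrite ler_pM2l// /K.
  have := ler_norm (- ln (e / 2)); rewrite normrN; lra.
rewrite ler0_norm//; lra.
Unshelve. all: by end_near. Qed.

Lemma entropyJE y : entropyJ y =
  2^-1 * ((1 + y) * ln (1 + y)) + 2^-1 * ((1 - y) * ln (1 - y)).
Proof. by rewrite /entropyJ !mulrA. Qed.

Lemma continuous_entropyJ : continuous (@entropyJ R).
Proof.
have -> : @entropyJ R = fun y =>
  2^-1 * ((1 + y) * ln (1 + y)) + 2^-1 * ((1 - y) * ln (1 - y)).
  by apply/funext => y; exact: entropyJE.
move=> y; apply: cvgD; apply: cvgM; try exact: cvg_cst.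
  apply: (@continuous_comp _ _ _ (fun y => 1 + y) (fun x => x * ln x)).
    by apply: cvgD; [exact: cvg_cst|exact: cvg_id].
  exact: continuous_xlnx.
apply: (@continuous_comp _ _ _ (fun y => 1 - y) (fun x => x * ln x)).
  by apply: cvgB; [exact: cvg_cst|exact: cvg_id].
exact: continuous_xlnx.
Qed.

Lemma entropyJ_ge0 y : `|y| <= 1 -> 0 <= entropyJ y.
Proof.
rewrite ler_norml entropyJE => /andP[y1 y2].
have := @xlnx_ge 1 (1 + y) ltr01 ltac:(lra).
have := @xlnx_ge 1 (1 - y) ltr01 ltac:(lra).
rewrite ln1; lra.
Qed.

Lemma entropyJ_le1 y : `|y| <= 1 -> entropyJ y <= 1.
Proof.
rewrite ler_norml entropyJE => /andP[y1 y2].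
have := @xlnx_le (1 + y) ltac:(lra).
have := @xlnx_le (1 - y) ltac:(lra).
nra.
Qed.

End Entropy.

Section BlockEnergy.
Variables (R : realType).
Implicit Type phi : excursion R.
Local Notation lambda := (@lebesgue_measure R).

Definition block_slope phi (m j : nat) : R :=
  m%:R * (phi (j.+1%:R / m%:R) - phi (j%:R / m%:R)).

Definition block_energy phi (m : nat) : R :=
  m%:R^-1 * \sum_(j < m) entropyJ (block_slope phi m j).

Lemma block_slope_le1 phi m j : `|block_slope phi m j| <= 1.
Proof.
have [->|m0] := posnP m; first by rewrite /block_slope mul0r normr0.
have m0' : 0 < m%:R :> R by rewrite ltr0n.
rewrite /block_slope normrM ger0_norm ?ler0n// -ler_pdivlMl// mulr1.
have le : j%:R / m%:R <= j.+1%:R / m%:R :> R.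
  by rewrite ler_pM2r ?invr_gt0// ler_nat.
apply: le_trans (excursion_incr phi le) _.
by rewrite -mulrBl -natr1 addrAC subrr add0r mul1r.
Qed.

Section StepFunctions.
Variable v : nat -> R.

Definition step_fun (m : nat) (t : R) : R :=
  \sum_(j < m) v j * \1_(`[j%:R / m%:R, j.+1%:R / m%:R[%classic) t.

Lemma step_funE m t : (0 < m)%N -> 0 <= t < 1 ->
  step_fun m t = v (Num.truncn (t * m%:R)).
Proof.
move=> m0 /andP[t0 t1]; have m0' : 0 < m%:R :> R by rewrite ltr0n.
set j := Num.truncn _.
have /andP[jt tj] : j%:R <= t * m%:R < j.+1%:R.
  by apply: truncn_itv; rewrite mulr_ge0// ltW.
have jm : (j < m)%N.
  by rewrite -(ltr_nat R); apply: le_lt_trans jt _; rewrite gtr_pMl.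
rewrite /step_fun (bigD1 (Ordinal jm))//= indicE mem_set ?mulr1; last first.
  by rewrite /= in_itv/= ler_pdivrMr// jt ltr_pdivlMr.
rewrite big1 ?addr0// => i /eqP ij.
rewrite indicE memNset ?mulr0//= in_itv/= ler_pdivrMr// ltr_pdivlMr//.
move=> /andP[it ti]; apply: ij; apply: val_inj => /=; apply/eqP.
rewrite eqn_leq -ltnS -[X in _ && X]ltnS -!(ltr_nat R).
by rewrite (le_lt_trans it tj) (le_lt_trans jt ti).
Qed.

Lemma step_fun1 m : step_fun m 1 = 0.
Proof.
rewrite /step_fun big1// => j _.
have m0 : (0 < m)%N by apply: leq_ltn_trans (ltn_ord j).
rewrite indicE memNset ?mulr0//= in_itv/= ltr_pdivlMr ?ltr0n// mul1r.
by rewrite ltr_nat ltnNge ltn_ord andbF.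
Qed.

Lemma measurable_step_fun m (D : set (measurableTypeR R)) :
  measurable_fun D (step_fun m).
Proof.
rewrite /step_fun; apply: measurable_sum => j.
apply: measurable_funM; first exact: measurable_cst.
by apply: measurable_indic; exact: measurable_itv.
Qed.

Lemma integral_step_fun m : (0 < m)%N -> (forall j, 0 <= v j) ->
  (\int[lambda]_(t in `[0%R, 1%R]) (step_fun m t)%:E)%E =
  (m%:R^-1 * \sum_(j < m) v j)%:E.
Proof.
move=> m0 v0; have m0' : 0 < m%:R :> R by rewrite ltr0n.
rewrite /step_fun.
under eq_integral do rewrite -sumEFin.
rewrite ge0_integral_sum//=; last 2 first.
- move=> j; apply/measurable_EFinP; apply: measurable_funM; first exact: measurable_cst.
  by apply: measurable_indic; exact: measurable_itv.
- by move=> j t _; rewrite lee_fin mulr_ge0.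
rewrite mulr_sumr -sumEFin; apply: eq_bigr => j _.
under eq_integral do rewrite EFinM.
rewrite ge0_integralZl//; [|by apply/measurable_EFinP; apply: measurable_indic;
  exact: measurable_itv|by rewrite lee_fin].
rewrite (@integral_indic _ _ _ lambda _ (measurable_itv _) _ (measurable_itv _)).
rewrite setIidl; last first.
  move=> t /=; rewrite !in_itv/= => /andP[a b]; apply/andP; split.
    by apply: le_trans a; rewrite divr_ge0// ler0n.
  apply: ltW; apply: lt_le_trans b _.
  by rewrite ler_pdivrMr// mul1r ler_nat.
have lt : j%:R / m%:R < j.+1%:R / m%:R :> R.
  by rewrite ltr_pM2r ?invr_gt0// ltr_nat.
have L : lambda `[j%:R / m%:R, j.+1%:R / m%:R[%classic = (m%:R^-1)%:E.
  rewrite lebesgue_measure_itv/= lte_fin lt -EFinD; congr EFin.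
  by rewrite -mulrBl -natr1 addrAC subrr add0r mul1r.
rewrite [in RHS]mulrC EFinM; congr (_ * _)%E; exact: L.
Qed.
End StepFunctions.

Lemma excursion_integrable phi :
  lambda.-integrable `[0, 1]%classic (EFin \o (phi : R -> R)).
Proof.
apply: continuous_compact_integrable; first exact: segment_compact.
by apply: continuous_subspaceT; exact: excursion_continuous.
Qed.

Lemma Rintegral_close (f g : R -> R) (c : R) :
  lambda.-integrable `[0, 1]%classic (EFin \o f) ->
  lambda.-integrable `[0, 1]%classic (EFin \o g) ->
  (forall t, 0 <= t <= 1 -> `|f t - g t| <= c) ->
  `| \int[lambda]_(t in `[0, 1]) f t - \int[lambda]_(t in `[0, 1]) g t | <= c.
Proof.
move=> intf intg close; rewrite -RintegralB//.
have intB : lambda.-integrable `[0, 1]%classic (EFin \o (fun t => f t - g t)).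
  by have := integrableB _ intf intg; apply.
have intN : lambda.-integrable `[0, 1]%classic (EFin \o (fun t => `|f t - g t|)).
  exact: integrable_norm intB.
have intC : lambda.-integrable `[0, 1]%classic (EFin \o (fun=> c)).
  apply: continuous_compact_integrable; first exact: segment_compact.
  by apply: continuous_subspaceT => x; exact: cvg_cst.
apply: le_trans (le_normr_Rintegral _ intB) _; first exact: measurable_itv.
have cE : \int[lambda]_(t in `[0, 1]) c = c.
  by rewrite Rintegral_cst//= lebesgue_measure_itv/= lte01 oppr0 adde0 mulr1.
rewrite -[leRHS]cE.
by apply: le_Rintegral => // t; rewrite /= in_itv/=; exact: close.
Qed.

Lemma excursion_integral_approx phi N : (0 < N)%N ->
  `| \int[lambda]_(t in `[0, 1]) phi t -
     N%:R^-1 * \sum_(k < N) phi (k%:R / N%:R) | <= N%:R^-1.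
Proof.
move=> N0; have N0' : 0 < N%:R :> R by rewrite ltr0n.
pose S := step_fun (fun k => phi (k%:R / N%:R)) N.
have phi0 k : 0 <= phi (k%:R / N%:R) by exact: excursion_ge0.
have close t : 0 <= t <= 1 -> `|phi t - S t| <= N%:R^-1.
  move=> /andP[t0]; rewrite le_eqVlt => /orP[/eqP->|t1].
    by rewrite /S step_fun1 excursion_at1 subrr normr0 invr_ge0 ltW.
  rewrite /S step_funE ?t0//.
  have /andP[jt tj] := truncn_itv (mulr_ge0 t0 (ltW N0')).
  have jt' : (Num.truncn (t * N%:R))%:R / N%:R <= t by rewrite ler_pdivrMr.
  apply: le_trans (excursion_incr phi jt') _.
  rewrite lerBlDl -[X in _ + X]mul1r -mulrDl ler_pdivlMr// natr1.
  exact: ltW.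
have intS : lambda.-integrable `[0, 1]%classic (EFin \o S).
  apply/integrableP; split; first by apply/measurable_EFinP; exact: measurable_step_fun.
  rewrite [ltLHS](_ : _ = (\int[lambda]_(t in `[0%R, 1%R]) (S t)%:E)%E); last first.
    apply: eq_integral => t _ /=; rewrite ger0_norm// /S /step_fun sumr_ge0// => j _.
    by rewrite mulr_ge0.
  by rewrite integral_step_fun// ltry.
have intphi := excursion_integrable phi.
have -> : N%:R^-1 * \sum_(k < N) phi (k%:R / N%:R) = \int[lambda]_(t in `[0, 1]) S t.
  by rewrite /Rintegral integral_step_fun.
exact: Rintegral_close.
Qed.

Definition block_entropy phi (m : nat) : R -> R :=
  step_fun (fun j => entropyJ (block_slope phi m j)) m.

Lemma block_entropyE phi m t : (0 < m)%N -> 0 <= t < 1 ->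
  block_entropy phi m t = entropyJ (block_slope phi m (Num.truncn (t * m%:R))).
Proof. exact: step_funE. Qed.

Lemma block_entropy_bound phi m t : (0 < m)%N -> 0 <= t <= 1 ->
  `|block_entropy phi m t| <= 1.
Proof.
move=> m0 /andP[t0]; rewrite le_eqVlt => /orP[/eqP->|t1]; last first.
  rewrite block_entropyE ?t0// ger0_norm ?entropyJ_ge0 ?entropyJ_le1//;
    exact: block_slope_le1.
by rewrite /block_entropy step_fun1 normr0.
Qed.

Lemma integral_block_entropy phi m : (0 < m)%N ->
  (\int[lambda]_(t in `[0%R, 1%R]) (block_entropy phi m t)%:E)%E = (block_energy phi m)%:E.
Proof.
by move=> m0; rewrite integral_step_fun// => j; exact/entropyJ_ge0/block_slope_le1.
Qed.

(** The block that contains [t] has [t] between its end points, so that the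
    difference quotients of the two sides combine. *)
Lemma block_slope_cvg phi t : 0 < t < 1 -> derivable (phi : R -> R) t 1 ->
  block_slope phi m.+1 (Num.truncn (t * m.+1%:R)) @[m --> \oo] --> derive1 phi t.
Proof.
move=> /andP[t0 t1] dphi; set d := derive1 phi t.
have cvgd : h^-1 *: (phi (h + t) - phi t) @[h --> (0 : R)^'] --> d.
  move: dphi; rewrite /derivable.
  have -> : (fun h : R => h^-1 *: ((phi \o shift t) (h *: (1 : R)) - phi t)) =
            (fun h : R => h^-1 *: (phi (h + t) - phi t)).
    by apply/funext => h /=; rewrite [h *: _]mulr1.
  by move/cvg_ex => [l cl]; rewrite /d /derive1 (cvg_lim _ cl).
apply/(@cvgrPdist_le _ R^o) => e e0.
move/(@cvgrPdist_le _ R^o) : cvgd => /(_ e e0)[r /= r0 near_d].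
have linear h : `|h| < r -> `|phi (t + h) - phi t - h * d| <= e * `|h|.
  move=> hr; have [->|h0] := eqVneq h 0.
    by rewrite addr0 subrr mul0r subrr normr0 mulr0.
  have := near_d h; rewrite /ball/= sub0r normrN => /(_ hr h0).
  rewrite -(ler_pM2r (_ : 0 < `|h|)) ?normr_gt0// -normrM.
  rewrite mulrBl [X in _ - X * _]mulrC -mulrA [h^-1 * h]mulVf// mulr1.
  by rewrite distrC [h + t]addrC [d * h]mulrC.
near=> m.
have m0 : 0 < m.+1%:R :> R by rewrite ltr0n.
have mr : m.+1%:R^-1 < r by near: m; exact: near_infty_natSinv_lt (PosNum r0).
set j := Num.truncn _.
have /andP[jt tj] : j%:R <= t * m.+1%:R < j.+1%:R.
  by apply: truncn_itv; rewrite mulr_ge0// ltW.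
pose a : R := j%:R / m.+1%:R; pose b : R := j.+1%:R / m.+1%:R.
have ab : b - a = m.+1%:R^-1.
  by rewrite /a /b -mulrBl -natr1 addrAC subrr add0r mul1r.
have at_ : a <= t by rewrite /a ler_pdivrMr.
have tb : t <= b by rewrite /b ler_pdivlMr// ltW.
have := linear (a - t); have := linear (b - t).
rewrite !subrKC (@ger0_norm _ (b - t)) ?subr_ge0// (@ler0_norm _ (a - t)) ?subr_le0//.
rewrite -ab in mr.
have bt : b - t < r by apply: le_lt_trans mr; rewrite lerD2l lerN2.
have ta : - (a - t) < r by apply: le_lt_trans mr; rewrite opprB lerD2r.
move=> /(_ bt) lb /(_ ta) la.
suff : `|block_slope phi m.+1 j - d| <= (e : R) by rewrite distrC.
rewrite /block_slope -/a -/b.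
have -> : m.+1%:R * (phi b - phi a) - d =
  m.+1%:R * ((phi b - phi t - (b - t) * d) - (phi a - phi t - (a - t) * d)).
  have -> : phi b - phi t - (b - t) * d - (phi a - phi t - (a - t) * d) =
            phi b - phi a - (b - a) * d by ring.
  by rewrite ab [RHS]mulrBr; congr (_ - _); rewrite mulrA mulfV ?mul1r// gt_eqF.
rewrite normrM (ger0_norm (ltW m0)) -ler_pdivlMl//.
apply: le_trans (ler_normB _ _) _.
apply: (@le_trans _ _ (e * (b - t) + e * - (a - t))); first exact: lerD.
by rewrite -mulrDr -ab [_ * e]mulrC ler_pM2l//; lra.
Unshelve. all: by end_near. Qed.

(** The block energy is the integral of a step function with values in [0, 1]
    that converges almost everywhere by [block_slope_cvg], and dominated
    convergence applies. *)
Lemma block_energy_cvg phi : block_energy phi m.+1 @[m --> \oo] -->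
  \int[lambda]_(t in `[0, 1]) entropyJ (derive1 phi t).
Proof.
have [h mh [N [mN N0 Nh]]] := excursion_ae_derivable phi.
have [M [mM M0 NM]] : lambda.-negligible (N `|` [set 0] `|` [set 1]).
  apply: negligibleU; last by apply/negligibleP => //; exact: lebesgue_measure_set1.
  apply: negligibleU; last by apply/negligibleP => //; exact: lebesgue_measure_set1.
  exact/negligibleP.
have off t : `[0, 1]%classic t -> ~ M t ->
    [/\ 0 < t < 1, derivable (phi : R -> R) t 1 & derive1 phi t = h t].
  rewrite /= in_itv/= => /andP[t0 t1] Mt.
  have t01 : 0 < t < 1.
    rewrite !lt_neqAle t0 t1 !andbT; apply/andP; split; apply/eqP => E; apply: Mt;
      apply: NM; [left; right|right] => //=.
  suff [] : derivable (phi : R -> R) t 1 /\ derive1 phi t = h t by [].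
  apply: contrapT => ntd; apply: Mt; apply: NM; left; left; apply: Nh => /= P.
  exact/ntd/P.
rewrite /Rintegral.
rewrite (@integral_eq_off_null _ _ _ _ _ M _ (fun t => (entropyJ (h t))%:E))//; last first.
  by move=> t t01 Mt; have [_ _ ->] := off t t01 Mt.
have mJ : measurable_fun (`[0, 1]%classic : set (measurableTypeR R))
    (fun t => (entropyJ (h t))%:E).
  apply/measurable_EFinP; apply: measurable_funTS.
  apply: measurableT_comp mh.
  by apply: continuous_measurable_fun; exact: continuous_entropyJ.
have [] := @dominated_convergence _ _ R lambda `[0, 1]%classic _
  (fun m t => (block_entropy phi m.+1 t)%:E) (fun t => (entropyJ (h t))%:E) (cst 1%E).
- exact: measurable_itv.
- by move=> m; apply/measurable_EFinP; exact: measurable_step_fun.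
- exact: mJ.
- exists M; split => // t /= /not_implyP[t01]; apply: contra_notP => Mt.
  have [/andP[t0 t1] dt <-] := off t t01 Mt.
  apply: cvg_EFin; first by apply: nearW.
  rewrite (_ : _ \o _ = fun m =>
      entropyJ (block_slope phi m.+1 (Num.truncn (t * m.+1%:R)))); last first.
    by apply/funext => m /=; rewrite block_entropyE// t1 ltW.
  have t01' : 0 < t < 1 by rewrite t0.
  have C := cvg_comp _ _ (block_slope_cvg t01' dt) (@continuous_entropyJ R _).
  exact: C.
- apply/integrableP; split; first exact: measurable_cst.
  under eq_integral do rewrite abse1.
  rewrite integral_cst//= mul1e lebesgue_measure_itv/= lte01 oppr0 adde0.
  exact: ltry.
- apply: aeW => t m t01; rewrite /= lee_fin.
  by apply: block_entropy_bound => //; move: t01; rewrite /= in_itv.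
move=> intJ _ cvgI.
have fin : (\int[lambda]_(t in `[0%R, 1%R]) (entropyJ (h t))%:E)%E \is a fin_num.
  exact: integrable_fin_num.
rewrite -(fineK fin) in cvgI.
rewrite (_ : (fun m => block_energy phi m.+1) = fine \o (fun n =>
  (\int[lambda]_(x in `[0%R, 1%R]) (block_entropy phi n.+1 x)%:E)%E)).
  exact: fine_cvg cvgI.
by apply/funext => m /=; rewrite integral_block_entropy.
Qed.

End BlockEnergy.

(** * The excursion of a permutation *)

Section BigMin.
Variables (R : realDomainType) (I : finType) (P : pred I) (F : I -> nat) (n : nat).

Lemma natr_bigminn : (\big[minn/n]_(i | P i) F i)%:R =
  \big[Num.min/n%:R]_(i | P i) (F i)%:R :> R.
Proof. by apply: (big_morph (fun k => k%:R)) => // x y; rewrite -minEnat natr_min. Qed.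

Lemma ler_bigminn (r : R) :
  r <= (\big[minn/n]_(i | P i) F i)%:R <->
  r <= n%:R /\ (forall i, P i -> r <= (F i)%:R).
Proof. by rewrite natr_bigminn; split=> [/bigmin_geP|H]; last exact/bigmin_geP. Qed.

Lemma bigminn_ler (r : R) :
  (\big[minn/n]_(i | P i) F i)%:R <= r <->
  n%:R <= r \/ (exists2 i, P i & (F i)%:R <= r).
Proof. by rewrite natr_bigminn; split=> [/bigmin_leP|H]; last exact/bigmin_leP. Qed.
End BigMin.

Section Successors.
Variable R : realType.
Implicit Type r : R.

Lemma ler_add1_S r k : (r + 1 <= k.+1%:R) = (r <= k%:R).
Proof. by rewrite -natr1 lerD2r. Qed.

Lemma leS_ler_add1 r k : (k.+1%:R <= r + 1) = (k%:R <= r).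
Proof. by rewrite -natr1 lerD2r. Qed.

End Successors.

Section Staircase.
Variables (R : realType) (n' : nat).
Local Notation n := n'.+1.
Implicit Type s : 'S_n.

(** In the coordinates [x = t + u] and [y = t - u], the region below a tent is the
    quadrant of the points above and to the left of an entry, by [le_tent]. *)
Definition tent s (i : 'I_n) (t : R) : R :=
  Num.min (t - (s i)%:R / n%:R) (i.+1%:R / n%:R - t).

Definition staircase s (t : R) : R := \big[Num.max/0]_(i < n) tent s i t.

Lemma n_gt0 : 0 < n%:R :> R. Proof. by rewrite ltr0n. Qed.

Lemma le_tent s i t u : (u <= tent s i t) =
  ((s i)%:R <= n%:R * (t - u)) && (n%:R * (t + u) <= i.+1%:R).
Proof.
rewrite /tent le_min; congr (_ && _).
  by rewrite lerBrDr addrC -lerBrDr ler_pdivrMr ?n_gt0// mulrC.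
by rewrite lerBrDr addrC ler_pdivlMr ?n_gt0// mulrC.
Qed.

(** By [low_diag], with [c] the integer part of [n * t]. *)
Lemma tent_ge0 s t : 0 <= t <= 1 -> exists i, 0 <= tent s i t.
Proof.
move=> /andP[t0]; rewrite le_eqVlt => /orP[/eqP->|t1].
  exists ord_max; rewrite le_tent addr0 subr0 mulr1 lexx andbT.
  by rewrite ler_nat ltnW.
have /andP[ct tc] := truncn_itv (mulr_ge0 (ltW n_gt0) t0).
have cn : (Num.truncn (n%:R * t) < n)%N.
  by rewrite -(ltr_nat R); apply: le_lt_trans ct _; rewrite gtr_pMr ?n_gt0.
have /lowP[i ci ic] := low_diag s cn.
exists i; rewrite le_tent addr0 subr0; apply/andP; split.
  by apply: le_trans ct; rewrite ler_nat.
by apply: le_trans (ltW tc) _; rewrite ler_nat.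
Qed.

Lemma le_staircase s t u : 0 <= t <= 1 ->
  u <= staircase s t <-> exists i, u <= tent s i t.
Proof.
move=> t01; split=> [|[i ui]]; last first.
  by apply: le_trans ui _; apply: le_bigmax.
by move/bigmax_geP => [u0|[i _ ui]]; [have [i i0] := tent_ge0 s t01; exists i;
  exact: le_trans i0|exists i].
Qed.

Lemma staircase_le s t u : 0 <= t <= 1 ->
  staircase s t <= u <-> forall i, tent s i t <= u.
Proof.
move=> t01; split=> [su i|su].
  by apply: le_trans su; apply: le_bigmax.
apply/bigmax_leP; split=> //.
by have [i i0] := tent_ge0 s t01; apply: le_trans i0 _.
Qed.

Lemma staircase_lip s x y : 0 <= x -> x <= y -> y <= 1 ->
  `|staircase s y - staircase s x| <= y - x.
Proof.
move=> x0 xy y1; have x01 : 0 <= x <= 1 by rewrite x0 (le_trans xy).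
have y01 : 0 <= y <= 1 by rewrite y1 (le_trans x0).
have half u v : 0 <= v <= 1 -> staircase s u <= staircase s v + `|u - v|.
  move=> v01; apply: bigmax_le => [|i _].
    by rewrite addr_ge0//; apply/bigmax_geP; left.
  rewrite -lerBlDr; apply: le_trans (le_bigmax _ _ i).
  have a1 : tent s i u <= u - (s i)%:R / n%:R by rewrite ge_min lexx.
  have a2 : tent s i u <= i.+1%:R / n%:R - u by rewrite ge_min lexx orbT.
  have := ler_norm (u - v); have := ler_norm (v - u); rewrite distrC => d1 d2.
  have lin1 (z a d p q : R) : z <= p - a -> p - q <= d -> z - d <= q - a by lra.
  have lin2 (z a d p q : R) : z <= a - p -> q - p <= d -> z - d <= a - q by lra.
  by rewrite [tent s i v]/tent le_min (lin1 _ _ _ _ _ a1 d2) (lin2 _ _ _ _ _ a2 d1).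
have := half y x x01; have := half x y y01.
rewrite distrC ger0_norm ?subr_ge0// => h1 h2.
by rewrite ler_norml; apply/andP; split; lra.
Qed.

Lemma staircase_ge0 s t : 0 <= t <= 1 -> 0 <= staircase s t.
Proof. by move=> _; apply/bigmax_geP; left. Qed.

Lemma staircase0 s : staircase s 0 = 0.
Proof.
apply/eqP; rewrite eq_le staircase_ge0 ?lexx ?ler01// andbT.
apply: bigmax_le => // i _; rewrite /tent ge_min sub0r oppr_le0.
by rewrite divr_ge0.
Qed.

Lemma staircase1 s : staircase s 1 = 0.
Proof.
apply/eqP; rewrite eq_le staircase_ge0 ?lexx ?ler01// andbT.
apply: bigmax_le => // i _; rewrite /tent ge_min; apply/orP; right.
by rewrite subr_le0 ler_pdivrMr ?n_gt0// mul1r ler_nat ltn_ord.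
Qed.

Definition staircase_excursion s : excursion R :=
  make_excursion (staircase_lip s) (@staircase_ge0 s) (staircase0 s) (staircase1 s).

Lemma staircase_excursionE s t : 0 <= t <= 1 ->
  staircase_excursion s t = staircase s t.
Proof. exact: make_excursionE. Qed.

Lemma le_future_min s (x y : R) : x < 1 ->
  y <= future_min s x <-> forall i : 'I_n, n%:R * x < i.+1%:R -> n%:R * y <= (s i)%:R.
Proof.
move=> x1; rewrite /future_min x1 ler_pdivlMr ?n_gt0// lerBrDr [y * _]mulrC.
rewrite ler_bigminn; split=> [[_ H] i ix|H].
  by have := H i ix; rewrite ler_add1_S.
split=> [|i ix]; last by rewrite ler_add1_S H.
apply: (@le_trans _ _ (s ord_max).+1%:R); last by rewrite ler_nat.
by rewrite ler_add1_S H//= gtr_pMr ?n_gt0.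
Qed.

Lemma future_min_left s (x : R) : 0 < x <= 1 -> left_limit (future_min s) x =
  ((\big[minn/n]_(i < n | n%:R * x <= i.+1%:R) (s i).+1)%:R - 1) / n%:R.
Proof.
move=> /andP[x0 x1]; rewrite /left_limit gt_eqF//.
apply: lim_near_cst => //; near=> y.
have yx : y < x by near: y; exact: nbhs_left_lt.
rewrite /future_min (lt_le_trans yx x1).
congr ((_%:R - 1) / _); apply: eq_bigl => i.
apply/idP/idP => [|xi]; last by apply: lt_le_trans xi; rewrite ltr_pM2l ?n_gt0.
apply: contraTT; rewrite -!ltNge -leNgt => ix.
suff : forall i : 'I_n, i.+1%:R < n%:R * x -> i.+1%:R <= n%:R * y by apply.
near: y; apply: filter_forall => j.
have [jx|xj] := ltP (j.+1%:R) (n%:R * x); last first.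
  exact: nearW.
have cx : n%:R^-1 * j.+1%:R < x by rewrite ltr_pdivrMl ?n_gt0.
apply: filterS (nbhs_left_gt cx) => y cy _.
by rewrite -ler_pdivrMl ?n_gt0//; exact: ltW.
Unshelve. all: by end_near. Qed.

Lemma left_limit_le s (x y : R) : 0 <= x <= 1 -> 0 <= y ->
  left_limit (future_min s) x <= y <->
  exists2 i : 'I_n, n%:R * x <= i.+1%:R & (s i)%:R <= n%:R * y.
Proof.
move=> /andP[x0 x1] y0; move: x0; rewrite le_eqVlt => /orP[/eqP<-|x0].
  rewrite /left_limit eqxx; split=> // _; exists ((s^-1)%g ord0).
    by rewrite mulr0.
  by rewrite permKV/= mulr_ge0.
rewrite future_min_left ?x0// ler_pdivrMr ?n_gt0// lerBlDr [y * _]mulrC.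
rewrite bigminn_ler; split=> [[ny|[i ix iy]]|[i ix iy]].
- exists ord_max; first by rewrite /= ger_pMr ?n_gt0.
  apply: le_trans (_ : n'%:R <= _); first by rewrite ler_nat -ltnS.
  by move: ny; rewrite leS_ler_add1.
- by exists i => //; move: iy; rewrite leS_ler_add1.
- by right; exists i => //; rewrite leS_ler_add1.
Qed.

(** The lower bound on [y] in the completed graph says that the point is below
    some tent, the upper bound that no tent passes strictly above it. *)
Lemma completed_graphE s (x y : R) : completed_graph (future_min s) (x, y) <->
  [/\ 0 <= x <= 1, 0 <= y <= 1 & staircase s ((x + y) / 2) = (x - y) / 2].
Proof.
have tu : n%:R * ((x + y) / 2 + (x - y) / 2) = n%:R * x by congr (_ * _); field.
have tl : n%:R * ((x + y) / 2 - (x - y) / 2) = n%:R * y by congr (_ * _); field.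
have key : 0 <= x <= 1 -> 0 <= y <= 1 ->
    (left_limit (future_min s) x <= y <= future_min s x <->
     staircase s ((x + y) / 2) = (x - y) / 2).
  move=> x01 y01; have /andP[x0 x1] := x01; have /andP[y0 y1] := y01.
  have t01 : 0 <= (x + y) / 2 <= 1 by apply/andP; split; lra.
  have lower : left_limit (future_min s) x <= y <->
      (x - y) / 2 <= staircase s ((x + y) / 2).
    rewrite left_limit_le// le_staircase//; split=> [[i ix iy]|[i H]]; exists i => //.
    - by rewrite le_tent tl tu iy ix.
    - by move: H; rewrite le_tent tl tu => /andP[].
    - by move: H; rewrite le_tent tl tu => /andP[].
  have upper : y <= future_min s x <-> staircase s ((x + y) / 2) <= (x - y) / 2.
    rewrite staircase_le//.
    have tentE i : (tent s i ((x + y) / 2) <= (x - y) / 2) =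
        (n%:R * y <= (s i)%:R) || (i.+1%:R <= n%:R * x).
      rewrite /tent ge_min; congr (_ || _).
        have lin (a : R) : ((x + y) / 2 - a <= (x - y) / 2) = (y <= a).
          by apply/idP/idP; lra.
        by rewrite lin ler_pdivlMr ?n_gt0// mulrC.
      have lin (a : R) : (a - (x + y) / 2 <= (x - y) / 2) = (a <= x).
        by apply/idP/idP; lra.
      by rewrite lin ler_pdivrMr ?n_gt0// mulrC.
    have [x1'|x1'] := ltP x 1.
      rewrite le_future_min//; split=> H i.
        by rewrite tentE; case: (leP (i.+1%:R) (n%:R * x)) => [|/H ->]; rewrite ?orbT.
      by move=> ix; have := H i; rewrite tentE => /orP[//|]; rewrite leNgt ix.
    rewrite /future_min ltNge x1'/=; split=> // _ i.
    rewrite tentE; apply/orP; right; apply: (@le_trans _ _ n%:R).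
      by rewrite ler_nat.
    by rewrite ler_pMr ?n_gt0.
  split=> [/andP[/lower l /upper u]|E]; first by apply/eqP; rewrite eq_le u l.
  by apply/andP; split; [apply/lower|apply/upper]; rewrite E.
rewrite /completed_graph /= !in_itv/=; split=> -[x01 y01].
  by move=> /(key x01 y01).
by move=> /(key x01 y01).
Qed.

Lemma completed_graph_staircase s :
  completed_graph (future_min s) = rotated_graph (staircase_excursion s).
Proof.
apply/seteqP; split=> [[x y] /completed_graphE[/andP[x0 x1] /andP[y0 y1] E]|_ [t t01 <-]].
  have t01 : 0 <= (x + y) / 2 <= 1 by apply/andP; split; lra.
  exists ((x + y) / 2); first by rewrite /= in_itv.
  by rewrite staircase_excursionE// E; congr (_, _); field.
rewrite /= in_itv/= in t01; have /andP[t0 t1] := t01.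
have := excursion_le_id (staircase_excursion s) t0.
have := excursion_le_onem (staircase_excursion s) t1.
have := excursion_ge0 (staircase_excursion s) t => p0 p1 p2.
apply/completed_graphE; split; [by apply/andP; split; lra|by apply/andP; split; lra|].
rewrite -staircase_excursionE//; last by apply/andP; split; lra.
set u := staircase_excursion s t.
have -> : (t + u + (t - u)) / 2 = t by field.
by rewrite -/u; field.
Qed.

Lemma perm_excursion_staircase s : perm_excursion R s = staircase_excursion s.
Proof.
set phi := perm_excursion R s.
have E : completed_graph (future_min s) = rotated_graph phi.
  have := @xgetPex _ (excursion0 R) [set psi : excursion R |
    completed_graph (future_min s) = rotated_graph psi].
  by apply; exists (staircase_excursion s); exact: completed_graph_staircase.
apply: excursion_ext => t t01.
have : rotated_graph phi (t + phi t, t - phi t) by exists t; rewrite //= in_itv.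
rewrite -E completed_graph_staircase => -[u _ [e1 e2]].
have ut : u = t by lra.
by rewrite ut in e1; lra.
Qed.

Lemma perm_excursionE s t : 0 <= t <= 1 -> perm_excursion R s t = staircase s t.
Proof. by move=> t01; rewrite perm_excursion_staircase staircase_excursionE. Qed.

Lemma perm_excursion_grid s k : (k <= 2 * n)%N ->
  perm_excursion R s (k%:R / (2 * n)%:R) = (height s k)%:R / (2 * n)%:R.
Proof.
move=> kn; have N0 : 0 < (2 * n)%:R :> R by rewrite ltr0n.
have t01 : 0 <= (k%:R / (2 * n)%:R : R) <= 1.
  by rewrite divr_ge0 ?(ltW N0)//= ler_pdivrMr// mul1r ler_nat.
have scale (m : nat) : m%:R / n%:R = (2 * m)%:R / (2 * n)%:R :> R.
  by rewrite !natrM -mulf_div divff ?mul1r ?pnatr_eq0.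
rewrite perm_excursionE//; apply/eqP; rewrite eq_le; apply/andP; split.
  apply: bigmax_le => [|i _]; first by rewrite divr_ge0 ?(ltW N0).
  apply: (@le_trans _ _ ((minn (k - 2 * s i) (2 * i.+1 - k))%:R / (2 * n)%:R)); last first.
    by rewrite ler_pM2r ?invr_gt0// ler_nat; exact: (@leq_bigmax _ (fun i : 'I_n => minn (k
      - 2 * s i) (2 * i.+1 - k)) i).
  rewrite /tent !scale -!mulrBl /minn; case: ifP => _; rewrite ge_min.
    by apply/orP; left; rewrite ler_pM2r ?invr_gt0// lerBlDr -natrD ler_nat; lia.
  by apply/orP; right; rewrite ler_pM2r ?invr_gt0// lerBlDr -natrD ler_nat; lia.
have [h0|h0] := posnP (height s k); first by rewrite h0 mul0r staircase_ge0.
have /(heightP _ _ h0)[i i1 i2] := leqnn (height s k).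
apply/le_staircase => //; exists i.
rewrite /tent !scale -!mulrBl le_min !ler_pM2r ?invr_gt0//.
by rewrite !lerBrDr -!natrD !ler_nat; apply/andP; split; lia.
Qed.

End Staircase.

(** * Families of lattice paths *)

Section Walk.
Implicit Type b : nat -> bool.

Definition walk b (k : nat) : int := \sum_(i < k) (if b i then 1 else -1).

Lemma walk0 b : walk b 0 = 0.
Proof. by rewrite /walk big_ord0. Qed.

Lemma walkS b k : walk b k.+1 = walk b k + (if b k then 1 else -1).
Proof. by rewrite /walk big_ord_recr. Qed.

Lemma walk_lip b k l : `|walk b (k + l) - walk b k| <= l%:Z.
Proof.
elim: l => [|l IH]; first by rewrite addn0 subrr.
by rewrite addnS walkS; case: (b _); lia.
Qed.

Lemma exists_walk_perm n b : (forall k, (k <= 2 * n)%N -> 0 <= walk b k) ->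
  walk b (2 * n) = 0 ->
  exists2 s : 'S_n, avoids231 s &
    forall k, (k <= 2 * n)%N -> (height s k)%:Z = walk b k.
Proof.
move=> b0 b1; pose D k := `|walk b k|%N.
have DE k : (k <= 2 * n)%N -> (D k)%:Z = walk b k.
  by move=> kn; rewrite /D gez0_abs// b0.
have dyckD : dyck n D.
  split; [by rewrite /D walk0|by rewrite /D b1|move=> k kn].
  by have := DE k (ltnW kn); have := DE k.+1 kn; rewrite walkS; case: (b k); lia.
have [s av hE] := exists_height dyckD.
by exists s => // k kn; rewrite hE// DE.
Qed.

End Walk.

(** The paths go up for [a] steps, then through [m] blocks of [L] steps of which
    [u j] are up-steps, and finally down for [a] steps.  At the ends of the blocks
    the height is at least [a], and [L <= a]; so the path remains nonnegative for
    every arrangement of the steps within the blocks. *)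
Section ManyExcursions.
Variables (n m L a : nat) (u : nat -> nat).
Hypothesis size_eq : (2 * a + m * L = 2 * n)%N.
Hypothesis L_gt0 : (0 < L)%N.
Hypothesis La : (L <= a)%N.
Definition grid_height (j : nat) : int := \sum_(i < j) (2 * (u i)%:Z - L%:Z).
Hypothesis grid_ge0 : forall j, (j <= m)%N -> 0 <= grid_height j.
Hypothesis grid_end : grid_height m = 0.

Definition block_bits (F : {ffun 'I_m -> {set 'I_L}}) (k : nat) : bool :=
  if (k < a)%N then true else
  [exists j : 'I_m, exists l : 'I_L, (k == a + j * L + l)%N && (l \in F j)].

Definition bit_family := family (fun j : 'I_m => [pred A : {set 'I_L} | #|A| == u j]).

Lemma block_bits_up F k : (k < a)%N -> block_bits F k.
Proof. by rewrite /block_bits => ->. Qed.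

Lemma block_bits_down F k : (a + m * L <= k)%N -> block_bits F k = false.
Proof.
move=> ak; rewrite /block_bits ltnNge (leq_trans (leq_addr _ _) ak)/=.
apply/negbTE/existsP => -[j /existsP[l /andP[/eqP kE _]]].
have : (j * L + l < m * L)%N.
  apply: (@leq_trans (j.+1 * L)); last by rewrite leq_pmul2r.
  by rewrite mulSn addnC ltn_add2r.
by rewrite ltnNge => /negP; apply; move: ak; rewrite kE -addnA leq_add2l.
Qed.

Lemma block_bits_mid F (j : 'I_m) (l : 'I_L) :
  block_bits F (a + j * L + l) = (l \in F j).
Proof.
rewrite /block_bits -addnA ltnNge leq_addr/=.
apply/existsP/idP => [[j' /existsP[l' /andP[/eqP E lF]]]|lF]; last first.
  by exists j; apply/existsP; exists l; rewrite addnA eqxx.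
move: E; rewrite -addnA => /addnI E.
have jj : j = j' :> nat.
  have := congr1 (fun x => x %/ L)%N E.
  by rewrite !divnMDl// !divn_small// !addn0.
have ll : l = l' :> nat by move: E; rewrite jj => /addnI.
by rewrite (val_inj jj) (val_inj ll).
Qed.

Lemma walk_up F k : (k <= a)%N -> walk (block_bits F) k = k%:Z.
Proof.
elim: k => [|k IH] ka; first by rewrite walk0.
by rewrite walkS block_bits_up// IH ?(ltnW ka)//; lia.
Qed.

Lemma walk_block F (j : 'I_m) : F \in bit_family ->
  walk (block_bits F) (a + j.+1 * L) =
  walk (block_bits F) (a + j * L) + (2 * (u j)%:Z - L%:Z).
Proof.
move=> /familyP/(_ j); rewrite inE => /eqP cardF.
have walk_add b k l : walk b (k + l) = walk b k + \sum_(i < l) (if b (k + i)%N then 1 else -1).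
  by elim: l => [|l IH]; rewrite ?addn0 ?big_ord0 ?addr0// addnS walkS IH big_ord_recr addrA.
rewrite mulSn [(L + _)%N]addnC addnA walk_add; congr (_ + _).
under eq_bigr do rewrite block_bits_mid.
rewrite -cardF (bigID (fun l => l \in F j))/=.
rewrite (eq_bigr (fun=> 1)); last by move=> l ->.
rewrite [X in _ + X](eq_bigr (fun=> -1)); last by move=> l /negbTE ->.
rewrite !sumr_const.
have le : (#|F j| <= L)%N by rewrite -[X in (_ <= X)%N]card_ord max_card.
have -> : #|[pred i | i \notin F j]| = (L - #|F j|)%N.
  apply/eqP; rewrite -(eqn_add2l #|F j|) subnKC//; apply/eqP.
  have := cardC (mem (F j)); rewrite [RHS]card_ord => E; rewrite -[RHS]E.
  by congr (_ + _)%N; apply: eq_card.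
have arith (c M : nat) : (c <= M)%N ->
    c%:R + (-1 : int) *+ (M - c) = 2 * c%:Z - M%:Z.
  by move=> cM; rewrite (natz c) mulNrn (natz (M - c)) -subzn//; lia.
rewrite [X in X%:R + _](_ : _ = #|F j|); last by apply: eq_card.
exact: arith.
Qed.

Lemma walk_grid F j : F \in bit_family -> (j <= m)%N ->
  walk (block_bits F) (a + j * L) = a%:Z + grid_height j.
Proof.
move=> FF; elim: j => [|j IH] jm.
  by rewrite mul0n addn0 walk_up// /grid_height big_ord0 addr0.
have := walk_block (Ordinal jm) FF; rewrite /= => ->.
by rewrite IH ?(ltnW jm)// /grid_height big_ord_recr/= [RHS]addrA.
Qed.

Lemma walk_down F k : F \in bit_family -> (k <= a)%N ->
  walk (block_bits F) (a + m * L + k) = (a - k)%N%:Z.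
Proof.
move=> FF; elim: k => [_|k IH ka].
  by rewrite addn0 walk_grid// grid_end addr0 subn0.
by rewrite addnS walkS block_bits_down ?leq_addr// IH ?(ltnW ka)//; lia.
Qed.

Lemma walk_ge0 F k : F \in bit_family -> (k <= 2 * n)%N ->
  0 <= walk (block_bits F) k.
Proof.
move=> FF kn; have [ka|ak] := leqP k a; first by rewrite walk_up.
have [km|mk] := leqP (a + m * L) k.
  by rewrite -(subnKC km) walk_down//; lia.
pose j := ((k - a) %/ L)%N.
have jm : (j < m)%N by rewrite ltn_divLR//; lia.
have kE : k = (a + j * L + (k - a) %% L)%N by rewrite -addnA -divn_eq subnKC// ltnW.
have := walk_lip (block_bits F) (a + j * L) ((k - a) %% L).
rewrite -kE walk_grid ?(ltnW jm)//.
have := grid_ge0 (ltnW jm); have := ltn_pmod (k - a) L_gt0.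
lia.
Qed.

Lemma many_excursions : exists S : {set 'S_n},
  (forall s, s \in S -> avoids231 s /\ forall j, (j <= m)%N ->
      (height s (a + j * L))%:Z = a%:Z + grid_height j) /\
  (\prod_(j < m) 'C(L, u j) <= #|S|)%N.
Proof.
have ex F : exists s : 'S_n, F \in bit_family -> avoids231 s /\
    forall k, (k <= 2 * n)%N -> (height s k)%:Z = walk (block_bits F) k.
  have [FF|nF] := boolP (F \in bit_family); last by exists 1%g.
  have [||s av hE] := @exists_walk_perm n (block_bits F).
  - by move=> k; exact: walk_ge0.
  - have -> : (2 * n = a + m * L + a)%N by lia.
    by rewrite walk_down// subnn.
  by exists s.
have [f fP] := choice ex.
exists (f @: [set F in bit_family]); split.
  move=> s /imsetP[F]; rewrite inE => FF ->.
  have [av hE] := fP F FF; split=> // j jm.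
  rewrite hE ?walk_grid// -size_eq mul2n -addnn -addnA leq_add2l.
  by apply: leq_trans (leq_addl _ _); rewrite leq_mul2r jm orbT.
rewrite card_in_imset; last first.
  move=> F G; rewrite !inE => FF GG fE.
  have [_ hF] := fP F FF; have [_ hG] := fP G GG.
  have wE k : (k <= 2 * n)%N -> walk (block_bits F) k = walk (block_bits G) k.
    by move=> kn; rewrite -hF// fE hG.
  apply/ffunP => j; apply/setP => l; rewrite -!block_bits_mid.
  have kn : (a + j * L + l < 2 * n)%N.
    rewrite -size_eq mul2n -addnn -!addnA ltn_add2l.
    apply: leq_trans (leq_addl _ _); apply: (@leq_trans (j.+1 * L)).
      by rewrite mulSn addnC ltn_add2r.
    by rewrite leq_mul2r ltn_ord orbT.
  have := wE _ kn; rewrite !walkS wE ?(ltnW kn)// => /addrI.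
  by case: (block_bits F _); case: (block_bits G _).
rewrite cardsE card_family foldrE big_map big_enum/=.
apply: leq_prod => j _.
rewrite -[X in 'C(X, _)](card_ord L) -card_draws.
by rewrite leq_eqVlt; apply/orP; left; apply/eqP/eq_card => A; rewrite !inE.
Qed.

End ManyExcursions.

Lemma ler_sum_subset (R : numDomainType) (T : finType) (A B : {set T})
    (F : T -> R) : A \subset B -> (forall i, 0 <= F i) ->
  \sum_(i in A) F i <= \sum_(i in B) F i.
Proof.
move=> AB F0; rewrite [leRHS](bigID (mem A))/=.
rewrite [X in _ <= X + _](eq_bigl (mem A)); last first.
  move=> i; rewrite /= andbC; case: (boolP (i \in A)) => //= iA.
  by rewrite (fintype.subsetP AB).
by rewrite lerDl sumr_ge0.
Qed.

Section FewExcursions.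
Variables (R : realFieldType) (n : nat).

Definition step (s : 'S_n) (i : nat) : R :=
  (height s i.+1)%:R - (height s i)%:R.

Lemma stepE s i : (i < 2 * n)%N ->
  step s i = if (height s i < height s i.+1)%N then 1 else -1.
Proof.
move=> ni; rewrite /step; have [->|->] := height_step s ni.
  by rewrite ltnSn -natr1 addrAC subrr add0r.
by rewrite ltnNge leqnSn -natr1 opprD addrA subrr add0r.
Qed.

(** The product is the probability of the path of [s] when step [i] goes up with
    probability [(1 + y i) / 2], independently.  Distinct 231-avoiding permutations
    have distinct paths, so that these probabilities add up to at most one. *)
Lemma few_excursions (S : {set 'S_n}) (y : nat -> R) (c : R) :
  (forall s, s \in S -> avoids231 s) -> (forall i, `|y i| <= 1) ->
  (forall s, s \in S -> c <= \prod_(i < 2 * n) ((1 + step s i * y i) / 2)) ->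
  #|S|%:R * c <= 1.
Proof.
move=> av y1 cQ.
pose q (i : 'I_(2 * n)) (b : bool) : R := (1 + (if b then 1 else -1) * y i) / 2.
have q0 i b : 0 <= q i b.
  have := y1 i; rewrite ler_norml /q => /andP[? ?].
  by rewrite divr_ge0//; case: b; lra.
have total : \sum_(w : {ffun 'I_(2 * n) -> bool}) \prod_i q i (w i) = 1.
  rewrite -bigA_distr_bigA big1// => i _.
  by rewrite big_bool/= /q; field.
pose word (s : 'S_n) := [ffun i : 'I_(2 * n) => (height s i < height s i.+1)%N].
have word_inj : {in S &, injective word}.
  move=> s s' sS s'S e; apply: height_inj; [exact: av|exact: av|].
  elim=> [|k IH] kn; first by rewrite !height0.
  have := congr1 (fun w : {ffun 'I_(2 * n) -> bool} => w (Ordinal kn)) e; rewrite !ffunE/=.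
  have := IH (ltnW kn); have := height_step s kn; have := height_step s' kn.
  case: ltnP; case: ltnP => //=; lia.
rewrite mulr_natl -sumr_const.
apply: (@le_trans _ _ (\sum_(s in S) \prod_i q i (word s i))).
  apply: ler_sum => s sS; apply: le_trans (cQ s sS) _.
  rewrite le_eqVlt; apply/orP; left; apply/eqP; apply: eq_bigr => i _.
  by rewrite /q ffunE stepE.
have /= <- := big_imset (fun w : {ffun 'I_(2 * n) -> bool} => \prod_i q i (w i)) word_inj.
rewrite -[leRHS]total [leRHS](eq_bigl (mem [set: {ffun 'I_(2 * n) -> bool}]%SET)).
  apply: ler_sum_subset => [|w]; last exact: prodr_ge0.
  by apply/fintype.subsetP => w; rewrite !inE.
by move=> w; rewrite /= inE.
Qed.
End FewExcursions.

(** * Inversions and area *)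

Section Weights.
Variable R : realType.
Local Notation lambda := (@lebesgue_measure R).

(** [height_area] is a Riemann sum of the excursion over the grid of mesh
    [1 / (2 * n)]. *)
Lemma perm_area n' (s : 'S_n'.+1) : avoids231 s ->
  `| (inversions s)%:R / n'.+1%:R -
     2 * n'.+1%:R * \int[lambda]_(t in `[0, 1]) perm_excursion R s t | <= 3 / 2.
Proof.
move=> av; set n := n'.+1; set I := \int[lambda]_(t in _) _.
have n0 : 0 < n%:R :> R by rewrite ltr0n.
have N0 : (0 < 2 * n)%N by rewrite muln_gt0.
have := excursion_integral_approx (perm_excursion R s) N0.
rewrite -/I; under eq_bigr => k _ do rewrite perm_excursion_grid ?(ltnW (ltn_ord k))//.
rewrite -mulr_suml -natr_sum height_area// natrD !natrM.
set v := (inversions s)%:R => H.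
have E : 2 * n%:R * (I - (2 * n%:R)^-1 * ((2 * v + n%:R) / (2 * n%:R))) =
    2 * n%:R * I - v / n%:R - 1 / 2.
  by field; rewrite pnatr_eq0.
have : `|2 * n%:R * (I - (2 * n%:R)^-1 * ((2 * v + n%:R) / (2 * n%:R)))| <= 1.
  rewrite normrM ger0_norm ?mulr_ge0 ?(ltW n0)//.
  by rewrite -ler_pdivlMl ?mulr_gt0// mulr1.
rewrite E !ler_norml => /andP[? ?]; apply/andP; split; lra.
Qed.

Definition avoiders_in n (V : set (excursion R)) : {set 'S_n} :=
  [set s | avoids231 s & `[< V (perm_excursion R s) >]].

Definition weight (beta : R) n (s : 'S_n) : R :=
  expR (beta / n%:R) ^+ inversions s.

(** The power of four is the number of paths with [2 * n] unit steps.  It cancels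
    in probabilities, and it makes the exponential rate equal to the energy,
    without additive constant. *)
Definition total_weight (beta : R) n (V : set (excursion R)) : R :=
  4^-1 ^+ n * \sum_(s in avoiders_in n V) weight beta s.

Lemma weight_gt0 beta n (s : 'S_n) : 0 < weight beta s.
Proof. by rewrite exprn_gt0// expR_gt0. Qed.

(** By [perm_area] the logarithm of the weight is [2 * beta * n] times the area
    under the excursion, up to a bounded error. *)
Lemma weight_bound (beta : R) n' (s : 'S_n'.+1) (phi : excursion R) (d : R) :
  avoids231 s ->
  `| \int[lambda]_(t in `[0, 1]) perm_excursion R s t -
     \int[lambda]_(t in `[0, 1]) phi t | <= d ->
  expR (n'.+1%:R * (2 * beta * \int[lambda]_(t in `[0, 1]) phi t - 2 * `|beta| * d) - 2 * `|beta|)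
    <= weight beta s <=
  expR (n'.+1%:R * (2 * beta * \int[lambda]_(t in `[0, 1]) phi t + 2 * `|beta| * d) + 2 *
    `|beta|).
Proof.
move=> av close; have area := perm_area av.
rewrite /weight -expRM_natl !ler_expR.
set I := \int[lambda]_(t in _) phi t in close *.
set I' := \int[lambda]_(t in _) perm_excursion R s t in close area *.
set n := n'.+1 in area *; set v := (inversions s)%:R in area *.
have n0 : 0 < n%:R :> R by rewrite ltr0n.
have E : v * (beta / n%:R) = n%:R * (2 * beta * I) +
   beta * (v / n%:R - 2 * n%:R * I') + 2 * n%:R * (beta * (I' - I)).
  by field; rewrite pnatr_eq0.
have b1 : `|beta * (v / n%:R - 2 * n%:R * I')| <= 2 * `|beta|.
  rewrite normrM [leRHS]mulrC ler_wpM2l//; lra.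
have b2 : `|2 * n%:R * (beta * (I' - I))| <= n%:R * (2 * `|beta| * d).
  rewrite !normrM (ger0_norm (ltW n0)) (@ger0_norm _ 2)//.
  have -> : n%:R * (2 * `|beta| * d) = 2 * n%:R * (`|beta| * d) by ring.
  by rewrite ler_wpM2l ?mulr_ge0 ?(ltW n0)// ler_wpM2l.
move: b1 b2; rewrite !ler_norml E !mulrDr => /andP[? ?] /andP[? ?].
rewrite mulrN; apply/andP; split; lra.
Qed.

Lemma excursion_integral_close (phi psi : excursion R) (d : R) :
  (forall t, 0 <= t <= 1 -> `|phi t - psi t| <= d) ->
  `| \int[lambda]_(t in `[0, 1]) phi t - \int[lambda]_(t in `[0, 1]) psi t | <= d.
Proof.
exact: (Rintegral_close (excursion_integrable phi) (excursion_integrable psi)).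
Qed.

End Weights.

(** * Entropy and Stirling estimates *)

Section DualEntropy.
Variable R : realType.
Implicit Types x y s : R.

(** The even and odd parts in [y] of [ln (1 + y)]: the log-likelihood of a step
    under a coin of bias [y] is affine in the sign of the step. *)
Definition ln_even y : R := 2^-1 * (ln (1 + y) + ln (1 - y)).
Definition ln_odd y : R := 2^-1 * (ln (1 + y) - ln (1 - y)).

Lemma entropyJ_ln_even_odd y : entropyJ y = ln_even y + y * ln_odd y.
Proof. by rewrite /entropyJ /ln_even /ln_odd; field. Qed.

(** The right-hand side is the log-likelihood per step of a block of slope [s]
    under a coin of bias [r * s]; replacing [s] by [r * s] in front of the odd part
    decreases it, because [s] and this odd part have the same sign. *)
Lemma entropyJ_dual r s : 0 <= r < 1 -> `|s| <= 1 ->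
  entropyJ (r * s) <= ln_even (r * s) + s * ln_odd (r * s).
Proof.
move=> /andP[r0 r1]; rewrite ler_norml => /andP[s0 s1].
rewrite entropyJ_ln_even_odd lerD2l -subr_ge0 -mulrBl.
have -> : (s - r * s) * ln_odd (r * s) = (1 - r) * (s * ln_odd (r * s)) by ring.
rewrite mulr_ge0 ?subr_ge0 ?(ltW r1)// /ln_odd mulrCA mulr_ge0//.
have b1 : 0 < 1 + r * s by nra.
have b2 : 0 < 1 - r * s by nra.
have [s_ge0|/ltW s_le0] := leP 0 s.
  by rewrite mulr_ge0// subr_ge0 ler_ln ?posrE//; nra.
by rewrite mulr_le0// subr_le0 ler_ln ?posrE//; nra.
Qed.

Lemma ln_sign y (b : bool) :
  ln (1 + (if b then 1 else -1) * y) =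
  ln_even y + (if b then 1 else -1) * ln_odd y.
Proof. by rewrite /ln_even /ln_odd; case: b; rewrite ?mul1r ?mulN1r; field. Qed.

(** A block of slope 1 or -1 would call for a deterministic coin, under which
    nearby paths have probability zero.  Shrinking all the slopes by a common
    factor avoids this at a small cost. *)
Lemma entropyJ_shrink m (s : nat -> R) e : 0 < e ->
  exists2 r, 0 <= r < 1 & forall j, (j < m)%N -> entropyJ (s j) - e <= entropyJ (r * s j).
Proof.
move=> e0.
have : \forall r \near (1 : R)^'-, forall j : 'I_m, entropyJ (s j) - e <= entropyJ (r * s j).
  apply: filter_forall => j.
  have c : entropyJ (r * s j) @[r --> (1 : R)^'-] --> entropyJ (1 * s j).
    have c1 : r * s j @[r --> (1 : R)^'-] --> 1 * s j.
      apply: cvg_at_left_filter.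
      by apply: cvgM; [exact: cvg_id|exact: cvg_cst].
    have C := cvg_comp _ _ c1 (@continuous_entropyJ R _); exact: C.
  move: c; rewrite mul1r => /(@cvgrPdist_le _ R^o)/(_ e e0).
  by apply: filterS => r; rewrite ler_norml => /andP[_]; rewrite lerBlDr addrC -lerBlDr.
move=> H; near (1 : R)^'- => r.
exists r; first by apply/andP; split; [apply: ltW; near: r; apply: nbhs_left_gt|near: r;
  apply: nbhs_left_lt].
by move=> j jm; have /(_ (Ordinal jm)) : forall j : 'I_m, entropyJ (s j) - e <= entropyJ (r
  * s j) by near: r.
Unshelve. all: by end_near. Qed.

Lemma entropyJ_upper_near m (s : nat -> R) e : 0 < e ->
  exists2 d, 0 < d & forall j z, (j < m)%N -> `|s j - z| < d -> entropyJ z <= entropyJ (s j) + e.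
Proof.
move=> e0.
have : \forall d \near (0 : R)^'+, forall j : 'I_m, forall z, `|s j - z| < d -> entropyJ z
  <= entropyJ (s j) + e.
  apply: filter_forall => j.
  have := @continuous_entropyJ R (s j).
  move=> /(@cvgrPdist_le _ R^o)/(_ e e0)[d /= d0 near_s].
  near=> d' => z zd; have := near_s z; rewrite /ball/= => H.
  have : `|entropyJ (s j) - entropyJ z| <= e.
    by apply: H; apply: lt_trans zd _; near: d'; apply: nbhs_right_lt.
  by rewrite ler_norml => /andP[? _]; lra.
move=> H; near (0 : R)^'+ => d.
exists d => // j z jm.
by have /(_ (Ordinal jm) z) : forall j : 'I_m, forall z, `|s j - z| < d -> entropyJ z <=
  entropyJ (s j) + e by near: d.
Unshelve. all: by end_near. Qed.

End DualEntropy.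

Section LnBinomial.
Variable R : realType.

Lemma ln_ratio_le (n : nat) : (0 < n)%N ->
  ln (n.+1%:R : R) - ln n%:R <= n%:R^-1.
Proof.
move=> n0; have n0' : 0 < n%:R :> R by rewrite ltr0n.
rewrite -ln_div ?posrE ?ltr0n//.
apply: le_trans (ln_le_subr1 _) _; first by rewrite divr_gt0// ltr0n.
by rewrite -natr1 mulrDl divff ?gt_eqF// mul1r addrAC subrr add0r.
Qed.

Lemma ln_ratio_ge (n : nat) : (0 < n)%N ->
  n.+1%:R^-1 <= ln (n.+1%:R : R) - ln n%:R.
Proof.
move=> n0; have n0' : 0 < n%:R :> R by rewrite ltr0n.
have n1' : 0 < n.+1%:R :> R by rewrite ltr0n.
have := ln_le_subr1 (divr_gt0 n0' n1').
rewrite ln_div ?posrE//.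
have -> : n%:R / n.+1%:R = 1 - n.+1%:R^-1 :> R.
  by rewrite -[n%:R](addrK 1) natr1 mulrBl divff ?gt_eqF// mul1r.
have lin (p q r : R) : q - p <= 1 - r - 1 -> r <= p - q by lra.
exact: lin.
Qed.

(** Stirling's formula up to a logarithmic error, by summing
    [1 / (n + 1) <= ln ((n + 1) / n) <= 1 / n]. *)
Lemma ln_fact_ge (n : nat) : n%:R * ln n%:R - n%:R <= ln (n`!%:R : R).
Proof.
elim: n => [|n IH]; first by rewrite mul0r subrr fact0 ln1.
rewrite factS natrM lnM ?posrE ?ltr0n ?fact_gt0//.
have [->|n0] := posnP n; first by rewrite fact0 !ln1; lra.
have := ln_ratio_le n0; rewrite -(ler_pM2l (_ : 0 < n%:R)) ?ltr0n// mulfV ?pnatr_eq0 -?lt0n//.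
have lin (x a b f : R) : x * b - x <= f -> x * (a - b) <= 1 ->
    (x + 1) * a - (x + 1) <= a + f by lra.
by move: (lin n%:R (ln n.+1%:R) (ln n%:R) (ln n`!%:R) IH); rewrite natr1.
Qed.

Lemma ln_fact_le (n : nat) :
  ln (n`!%:R : R) <= n%:R * ln n%:R - n%:R + 1 + ln n.+1%:R.
Proof.
have pos k : ln (k.+1`!%:R : R) <= k.+1%:R * ln k.+1%:R - k.+1%:R + 1 + ln k.+1%:R.
  elim: k => [|k IH]; first by rewrite !ln1; lra.
  rewrite factS natrM lnM ?posrE ?ltr0n ?fact_gt0//.
  have := @ln_ratio_ge k.+1 isT; rewrite -(ler_pM2l (_ : 0 < k.+2%:R)) ?ltr0n//.
  rewrite mulfV ?pnatr_eq0// => H.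
  have lin (x a b f : R) : f <= x * b - x + 1 + b -> 1 <= (x + 1) * (a - b) ->
    a + f <= (x + 1) * a - (x + 1) + 1 + a by lra.
  move: (lin k.+1%:R (ln k.+2%:R) (ln k.+1%:R) (ln k.+1`!%:R) IH).
  by rewrite natr1; apply.
case: n => [|n]; first by rewrite fact0 ln1 mul0r; lra.
apply: le_trans (pos n) _; rewrite lerD2l ler_ln ?posrE ?ltr0n//.
by rewrite ler_nat.
Qed.

Lemma ln_bin_ge (L u : nat) : (0 < L)%N -> (u <= L)%N ->
  L%:R * ln 2 - L%:R * entropyJ ((2 * u%:R - L%:R) / L%:R) - 2 - 2 * ln L.+1%:R
    <= ln ('C(L, u)%:R : R).
Proof.
move=> L0 uL; have L0' : 0 < L%:R :> R by rewrite ltr0n.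
pose d := (L - u)%N.
have dE : d%:R = L%:R - u%:R :> R by rewrite natrB.
have lnC : ln ('C(L, u)%:R : R) = ln L`!%:R - ln u`!%:R - ln d`!%:R.
  rewrite -(bin_fact uL) !natrM !lnM ?posrE ?mulr_gt0 ?ltr0n ?fact_gt0 ?bin_gt0//.
  by ring.
have half (k : nat) : (k <= L)%N ->
    L%:R * (2^-1 * (2 * k%:R / L%:R) * ln (2 * k%:R / L%:R)) =
    k%:R * ln 2 + k%:R * ln k%:R - k%:R * ln L%:R :> R.
  move=> kL; have [->|k0] := posnP k; first by rewrite !(mulr0, mul0r); ring.
  have k0' : 0 < k%:R :> R by rewrite ltr0n.
  rewrite ln_div ?posrE ?mulr_gt0// lnM ?posrE//.
  by field; rewrite gt_eqF.
have JE : L%:R * entropyJ ((2 * u%:R - L%:R) / L%:R) =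
    L%:R * ln 2 - L%:R * ln L%:R + u%:R * ln u%:R + d%:R * ln d%:R :> R.
  rewrite /entropyJ.
  have -> : 1 + (2 * u%:R - L%:R) / L%:R = 2 * u%:R / L%:R :> R by field; rewrite gt_eqF.
  have -> : 1 - (2 * u%:R - L%:R) / L%:R = 2 * d%:R / L%:R :> R.
    by rewrite dE; field; rewrite gt_eqF.
  rewrite mulrDr !half ?leq_subr// dE; ring.
rewrite JE lnC.
have h1 := ln_fact_ge L; have h2 := ln_fact_le u; have h3 := ln_fact_le d.
have m1 : ln (u.+1%:R : R) <= ln L.+1%:R by rewrite ler_ln ?posrE ?ltr0n// ler_nat.
have m2 : ln (d.+1%:R : R) <= ln L.+1%:R.
  by rewrite ler_ln ?posrE ?ltr0n// ler_nat ltnS leq_subr.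
have dE' : u%:R + d%:R = L%:R :> R by rewrite dE; ring.
move: h1 h2 h3 m1 m2 dE'.
set A := L%:R * ln L%:R; set B := u%:R * ln u%:R; set C := d%:R * ln d%:R.
lra.
Qed.

Lemma ln_sublinear_eventually (e : R) : 0 < e ->
  exists C : R, forall x, 0 < x -> ln x <= e * x + C.
Proof.
move=> e0; exists (ln e^-1 - 1) => x x0.
have := ln_le_subr1 (mulr_gt0 e0 x0).
rewrite lnM ?posrE// lnV ?posrE//; lra.
Qed.

End LnBinomial.

(** * Counting excursions near a given one *)

Section UpperCount.
Variable R : realType.
Local Notation lambda := (@lebesgue_measure R).

Lemma sum_blocks (G : nat -> R) (m L N : nat) : (m * L <= N)%N ->
  (forall i, (m * L <= i)%N -> G i = 0) ->
  \sum_(i < N) G i = \sum_(j < m) \sum_(l < L) G (j * L + l)%N.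
Proof.
move=> mN G0.
rewrite -(big_mkord xpredT G) (big_cat_nat (n := (m * L)%N))//=.
rewrite [X in _ + X]big_nat_cond [X in _ + X]big1 ?addr0; last first.
  by move=> i /andP[/andP[mi _] _]; exact: G0.
elim: m {mN G0} => [|m IH]; first by rewrite mul0n big_geq// big_ord0.
rewrite (big_cat_nat (n := (m * L)%N))//=; last by rewrite leq_mul2r leqnSn orbT.
rewrite IH big_ord_recr/=; congr (_ + _).
rewrite -{1}[(m * L)%N]add0n big_addn mulSn addnK big_mkord.
by apply: eq_bigr => l _; rewrite addnC.
Qed.

Lemma sum_step n (s : 'S_n) k L :
  \sum_(l < L) step R s (k + l) = (height s (k + L))%:R - (height s k)%:R.
Proof.
elim: L => [|L IH]; first by rewrite big_ord0 addn0 subrr.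
by rewrite big_ord_recr/= IH /step addnS; ring.
Qed.

(** With a bias that is constant on each of [m] blocks of [L] steps and zero on the
    remaining steps, the likelihood of a path depends only on its heights at the
    ends of the blocks. *)
Lemma step_product n (s : 'S_n) (m L : nat) (y : nat -> R) :
  (0 < L)%N -> (m * L <= 2 * n)%N -> (forall j, `|y j| < 1) ->
  \prod_(i < 2 * n) ((1 + step R s i * (if (i %/ L < m)%N then y (i %/ L)%N else 0)) / 2) =
  4^-1 ^+ n * expR (\sum_(j < m) (L%:R * ln_even (y j) +
     ln_odd (y j) * ((height s (j.+1 * L))%:R - (height s (j * L))%:R))).
Proof.
move=> L0 mL y1.
pose y' i := if (i %/ L < m)%N then y (i %/ L)%N else 0.
have y'1 i : `|y' i| < 1 by rewrite /y'; case: ifP => _; rewrite ?normr0.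
rewrite big_split/= prodr_const card_ord [RHS]mulrC; congr (_ * _); last first.
  by rewrite exprM; congr (_ ^+ _); rewrite expr2 -invfM -natrM.
pose G i := ln_even (y' i) + step R s i * ln_odd (y' i).
transitivity (\prod_(i < 2 * n) expR (G i)).
  apply: eq_bigr => i _; rewrite -/(y' i) /G stepE// -ln_sign lnK//.
  rewrite posrE; have := y'1 i; rewrite ltr_norml => /andP[? ?].
  by case: ifP => _; lra.
rewrite -expR_sum; congr expR.
have y'_out i : (m * L <= i)%N -> y' i = 0.
  by move=> mi; rewrite /y' ltnNge leq_divRL// mi.
rewrite (sum_blocks mL); last first.
  by move=> i mi; rewrite /G y'_out// /ln_even /ln_odd !(addr0, subr0) ln1 !(addr0, subrr, mulr0).
apply: eq_bigr => j _.
have y'E (l : 'I_L) : y' (j * L + l)%N = y j.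
  by rewrite /y' divnMDl// divn_small// addn0 ltn_ord.
rewrite /G; under eq_bigr do rewrite y'E.
rewrite big_split/= sumr_const card_ord -mulr_suml sum_step mulr_natl [_ * ln_odd _]mulrC.
by rewrite mulSn [(L + _)%N]addnC.
Qed.

Variable phi0 : excursion R.
Local Notation I0 := (\int[lambda]_(t in `[0, 1]) entropyJ (derive1 phi0 t)).

Lemma block_energy_near e : 0 < e -> exists M, forall m, (M <= m)%N ->
  `|block_energy phi0 m.+1 - I0| <= e.
Proof.
move=> e0; move/(@cvgrPdist_le _ R^o) : (@block_energy_cvg R phi0) => /(_ _ e0)[M _ HM].
by exists M => m mM; rewrite distrC; exact: HM.
Qed.

(** Toss on each block a coin whose bias is the slope of [phi0], slightly shrunk.
    By [step_product] and [entropyJ_dual] all the paths close to [phi0] have at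
    least the probability that the block energy predicts, and [few_excursions]
    then limits their number. *)
Lemma upper_count e : 0 < e -> exists2 d, 0 < d & exists C : R,
  \forall n' \near \oo, forall S : {set 'S_n'.+1},
    (forall s, s \in S -> avoids231 s /\
       forall t, 0 <= t <= 1 -> `|phi0 t - perm_excursion R s t| <= d) ->
    4^-1 ^+ n'.+1 * #|S|%:R <= expR (n'.+1%:R * (- (2 * I0) + e) + C).
Proof.
move=> e0; have e8 : 0 < e / 8 by rewrite divr_gt0.
have [m' Im] : exists m', I0 - e / 8 <= block_energy phi0 m'.+1.
  have [M HM] := block_energy_near e8.
  by exists M; have := HM M (leqnn M); rewrite ler_norml => /andP[? ?]; lra.
pose m := m'.+1; have m0 : 0 < m%:R :> R by rewrite ltr0n.
pose sl j := block_slope phi0 m j.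
have sl1 j : `|sl j| <= 1 by exact: block_slope_le1.
have [r r01 Jr] := entropyJ_shrink m sl e8.
have /andP[r0 r1] := r01.
pose y j := r * sl j.
have y1 j : `|y j| < 1.
  by rewrite /y normrM (ger0_norm r0); apply: le_lt_trans r1; rewrite ler_piMr.
pose K := \sum_(j < m) (`|ln_even (y j)| + `|ln_odd (y j)|).
have K0 : 0 <= K by apply: sumr_ge0 => j _; exact: addr_ge0.
(* With this radius, replacing the heights of a path by those of [phi0] changes
   the log-likelihood by at most [n * e / 2]. *)
exists (e / (8 * (K + 1))); first by rewrite divr_gt0// mulr_gt0// ltr_wpDl.
set d := e / _.
have d0 : 0 < d by rewrite divr_gt0// mulr_gt0// ltr_wpDl.
have Kd : K * d <= e / 8.
  have K1 : 0 < K + 1 by rewrite ltr_wpDl.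
  rewrite /d mulrA ler_pdivrMr ?mulr_gt0//.
  have -> : e / 8 * (8 * (K + 1)) = K * e + e by field.
  by rewrite lerDl ltW.
(* This constant pays for rounding [2 * n / m] down to the integer [L]. *)
exists (K * (2 * m%:R + 1)).
exists m => // n' /= mn S Sclose; set n := n'.+1.
have n0 : 0 < n%:R :> R by rewrite ltr0n.
pose L := (2 * n %/ m)%N.
have L0 : (0 < L)%N by rewrite divn_gt0// (leq_trans mn)// mul2n -addnn addSn leqW// leq_addr.
have mL : (m * L <= 2 * n)%N by rewrite mulnC leq_trunc_div.
have Lm : (2 * n < m * L.+1)%N by rewrite [(m * _)%N]mulnC ltn_ceil.
have LE : `|L%:R - 2 * n%:R / m%:R| <= 1 :> R.
  rewrite ler_norml; apply/andP; split.
    rewrite lerBrDl lerBlDr ler_pdivrMr// natr1 -!natrM ler_nat.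
    by rewrite [(L.+1 * _)%N]mulnC ltnW.
  apply: (@le_trans _ _ 0) => //; rewrite subr_le0 ler_pdivlMr// -!natrM ler_nat.
  by rewrite [(L * _)%N]mulnC.
have key s : s \in S -> 4^-1 ^+ n * expR (n%:R * (2 * I0 - e) - K * (2 * m%:R + 1)) <=
    \prod_(i < 2 * n) ((1 + step R s i * (if (i %/ L < m)%N then y (i %/ L)%N else 0)) / 2).
  move=> /Sclose[av close].
  rewrite step_product// ler_pM2l ?exprn_gt0// ler_expR.
  pose h j : R := (height s (j.+1 * L))%:R - (height s (j * L))%:R.
  have hE j : (j < m)%N -> `|h j - 2 * n%:R / m%:R * sl j| <= 4 * n%:R * d + 2 * m%:R.
    move=> jm.
    have grid i : (i <= m)%N ->
        `|(height s (i * L))%:R - 2 * n%:R * phi0 (i%:R / m%:R)| <= 2 * n%:R * d + m%:R.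
      move=> im.
      have iL : (i * L <= 2 * n)%N.
        by apply: leq_trans mL; rewrite leq_mul2r im orbT.
      have N0 : 0 < (2 * n)%:R :> R by rewrite ltr0n.
      pose x' : R := (i * L)%:R / (2 * n)%:R.
      have x'01 : 0 <= x' <= 1.
        by rewrite divr_ge0 ?(ltW N0)//= ler_pdivrMr// mul1r ler_nat.
      have DE : (height s (i * L))%:R = 2 * n%:R * perm_excursion R s x'.
        by rewrite /x' perm_excursion_grid// -natrM mulrCA mulfV ?mulr1 ?gt_eqF.
      have shift : 2 * n%:R * `|x' - i%:R / m%:R| <= m%:R.
        rewrite -[X in X * _]ger0_norm ?mulr_ge0 ?(ltW n0)// -normrM.
        have -> : 2 * n%:R * (x' - i%:R / m%:R) = i%:R * (L%:R - 2 * n%:R / m%:R).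
          by rewrite /x' !natrM; field; rewrite !gt_eqF.
        rewrite normrM normr_nat; apply: (@le_trans _ _ (i%:R * 1)).
          by rewrite ler_wpM2l.
        by rewrite mulr1 ler_nat.
      have c1 := close x' x'01; have c2 := excursion_lip phi0 x' (i%:R / m%:R).
      rewrite DE -mulrBr normrM (@ger0_norm _ (2 * n%:R)) ?mulr_ge0 ?(ltW n0)//.
      apply: (@le_trans _ _ (2 * n%:R * (d + `|x' - i%:R / m%:R|))).
        rewrite ler_wpM2l ?mulr_ge0 ?(ltW n0)//.
        move: c1 c2; set u := perm_excursion R s x'; set v := phi0 x'.
        set w := phi0 _ => c1 c2.
        have -> : u - w = - (v - u) + (v - w) by ring.
        by apply: le_trans (ler_normD _ _) _; rewrite normrN lerD.
      by rewrite mulrDr lerD2l.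
    have -> : h j - 2 * n%:R / m%:R * sl j =
        ((height s (j.+1 * L))%:R - 2 * n%:R * phi0 (j.+1%:R / m%:R)) -
        ((height s (j * L))%:R - 2 * n%:R * phi0 (j%:R / m%:R)).
      by rewrite /h /sl /block_slope; field; rewrite gt_eqF.
    apply: le_trans (ler_normB _ _) _.
    have g1 := grid j.+1 jm; have g2 := grid j (ltnW jm).
    by apply: le_trans (lerD g1 g2) _; lra.
  have termwise j : (j < m)%N ->
     2 * n%:R / m%:R * (entropyJ (sl j) - e / 8) -
       (`|ln_even (y j)| + `|ln_odd (y j)|) * (4 * n%:R * d + 2 * m%:R + 1) <=
     L%:R * ln_even (y j) + ln_odd (y j) * h j.
    move=> jm; set a := ln_even (y j); set l := ln_odd (y j); set q := 2 * n%:R / m%:R.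
    have q0 : 0 <= q by rewrite divr_ge0 ?mulr_ge0 ?(ltW n0) ?(ltW m0).
    have dual : q * (entropyJ (sl j) - e / 8) <= q * (a + sl j * l).
      rewrite ler_wpM2l//; apply: le_trans (Jr j jm) _; exact: entropyJ_dual.
    have b1 : `|a * (L%:R - q)| <= `|a| by rewrite normrM ler_piMr.
    have b2 : `|l * (h j - q * sl j)| <= `|l| * (4 * n%:R * d + 2 * m%:R).
      by rewrite normrM ler_wpM2l// hE.
    have big0 : 0 <= 4 * n%:R * d + 2 * m%:R.
      by apply: addr_ge0; [apply: (mulr_ge0 _ (ltW d0)); rewrite mulr_ge0 ?(ltW n0)|
        rewrite mulr_ge0 ?(ltW m0)].
    have b3 : 0 <= `|a| * (4 * n%:R * d + 2 * m%:R) by rewrite mulr_ge0.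
    move: b1 b2 b3 dual; rewrite !ler_norml => /andP[b1 _] /andP[b2 _].
    have := normr_ge0 l.
    set B := 4 * n%:R * d + 2 * m%:R in big0 b2 *; lra.
  apply: (@le_trans _ _ (\sum_(j < m) (2 * n%:R / m%:R * (entropyJ (sl j) - e / 8) -
       (`|ln_even (y j)| + `|ln_odd (y j)|) * (4 * n%:R * d + 2 * m%:R + 1)))); last first.
    by apply: ler_sum => j _; exact: termwise.
  rewrite sumrB -mulr_suml -/K -mulr_sumr sumrB sumr_const card_ord -[e / 8 *+ m]mulr_natr.
  have -> : \sum_(j < m) entropyJ (sl j) = m%:R * block_energy phi0 m.
    by rewrite /block_energy mulrA mulfV ?mul1r ?gt_eqF.
  have -> : 2 * n%:R / m%:R * (m%:R * block_energy phi0 m - e / 8 * m%:R) =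
      2 * n%:R * (block_energy phi0 m - e / 8) by field; rewrite gt_eqF.
  have b1 : n%:R * (I0 - e / 8) <= n%:R * block_energy phi0 m.
    by rewrite ler_wpM2l ?(ltW n0).
  have b2 : n%:R * (K * d) <= n%:R * (e / 8) by rewrite ler_wpM2l ?(ltW n0).
  move: b1 b2; set BE := block_energy _ _; set I := Rintegral _ _ _; lra.
have y'1 i : `|if (i %/ L < m)%N then y (i %/ L)%N else 0| <= 1.
  by case: ifP => _; rewrite ?normr0// ltW.
have := few_excursions (fun s sS => (Sclose s sS).1) y'1 key.
rewrite mulrA -ler_pdivlMr ?expR_gt0// mul1r -expRN.
rewrite [_ * 4^-1 ^+ n]mulrC => H; apply: le_trans H _.
by rewrite ler_expR; lra.
Qed.

End UpperCount.

Section LowerCount.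
Variable R : realType.
Local Notation lambda := (@lebesgue_measure R).
Variable phi0 : excursion R.
Local Notation I0 := (\int[lambda]_(t in `[0, 1]) entropyJ (derive1 phi0 t)).

Section Discretisation.
Variables (n m : nat).
Hypothesis m_gt0 : (0 < m)%N.
Hypothesis mn : (m.+2 <= n)%N.

(** Blocks of even length keep the heights at their ends of the parity of the ramp;
    dividing by [m.+2] rather than [m] leaves two ramps at least as long as a
    block. *)
Definition half_block : nat := (n %/ m.+2)%N.
Local Notation q := half_block.
Definition ramp : nat := (n - m * q)%N.
Local Notation a := ramp.
Local Notation L := (2 * q)%N.

(** Half of the height above the ramp that a path along [phi0] should have at the
    end of block [j]. *)
Definition grid_target (j : nat) : R := q%:R * m%:R * phi0 (j%:R / m%:R).
Definition grid_floor (j : nat) : nat := Num.truncn (grid_target j).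
Definition block_ups (j : nat) : nat := (q + grid_floor j.+1 - grid_floor j)%N.

Lemma half_block_gt0 : (0 < q)%N.
Proof. by rewrite divn_gt0. Qed.

Lemma mq_le : (m.+2 * q <= n)%N.
Proof. by rewrite [(m.+2 * _)%N]mulnC leq_trunc_div. Qed.

Lemma lt_mqS : (n < m.+2 * q.+1)%N.
Proof. by rewrite [(m.+2 * _)%N]mulnC ltn_ceil. Qed.

Lemma ramp_size : (2 * a + m * L = 2 * n)%N.
Proof.
rewrite /ramp mulnCA -mulnDr subnK//; apply: leq_trans mq_le.
by rewrite leq_mul2r ltnW ?orbT.
Qed.

Lemma block_le_ramp : (L <= a)%N.
Proof. by rewrite /ramp; have := mq_le; rewrite !mulSn; lia. Qed.

Lemma grid_target_ge0 j : 0 <= grid_target j.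
Proof. by rewrite !mulr_ge0// excursion_ge0. Qed.

Lemma grid_floor_itv j : (grid_floor j)%:R <= grid_target j < (grid_floor j)%:R + 1.
Proof. by rewrite natr1; exact: truncn_itv (grid_target_ge0 j). Qed.

Lemma grid_target_slope j :
  grid_target j.+1 - grid_target j = q%:R * block_slope phi0 m j.
Proof. by rewrite /grid_target /block_slope -mulrBr mulrA. Qed.

Lemma grid_floor_step j : (grid_floor j.+1 <= grid_floor j + q)%N /\
  (grid_floor j <= grid_floor j.+1 + q)%N.
Proof.
have /andP[a1 a2] := grid_floor_itv j; have /andP[b1 b2] := grid_floor_itv j.+1.
have E := grid_target_slope j.
have : `|q%:R * block_slope phi0 m j| <= q%:R.
  by rewrite normrM normr_nat ler_piMr// block_slope_le1.
rewrite -E ler_norml => /andP[c1 c2].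
split; rewrite -ltnS -(ltr_nat R) -natr1 natrD; lra.
Qed.

Lemma grid_floor_end j : (j = 0)%N \/ j = m -> grid_floor j = 0%N.
Proof.
move=> jE; rewrite /grid_floor /grid_target.
have -> : phi0 (j%:R / m%:R) = 0.
  case: jE => ->; first by rewrite mul0r excursion_at0.
  by rewrite divff ?pnatr_eq0 -?lt0n// excursion_at1.
by rewrite mulr0 truncn0.
Qed.

Lemma grid_heightE j : grid_height L block_ups j = 2 * (grid_floor j)%:Z.
Proof.
elim: j => [|j IH]; first by rewrite /grid_height big_ord0 grid_floor_end//; left.
rewrite /grid_height big_ord_recr/= -/(grid_height L block_ups j) IH /block_ups.
by have := grid_floor_step j; lia.
Qed.

Lemma shadowing_excursions : exists S : {set 'S_n},
  (forall s, s \in S -> avoids231 s /\ forall j, (j <= m)%N ->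
      height s (a + j * L) = (a + 2 * grid_floor j)%N) /\
  (\prod_(j < m) 'C(L, block_ups j) <= #|S|)%N.
Proof.
have L0 : (0 < L)%N by rewrite muln_gt0 half_block_gt0.
have [||S [SP cardS]] := many_excursions ramp_size L0 block_le_ramp (u := block_ups).
- by move=> j _; rewrite grid_heightE; lia.
- by rewrite grid_heightE grid_floor_end//; right.
exists S; split=> // s /SP[av hE]; split=> // j jm.
by have := hE j jm; rewrite grid_heightE; lia.
Qed.

End Discretisation.

(** Compare both functions at the nearest end of a block.  The ramps dominate the
    error: they are at most a multiple of [n / m] long, by [ramp_le]. *)
Lemma shadowing_close n' m (s : 'S_n'.+1) (t : R) : (0 < m)%N -> (m.+2 <= n'.+1)%N ->
  (forall j, (j <= m)%N -> height s (ramp n'.+1 m + j * (2 * half_block n'.+1 m)) =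
     (ramp n'.+1 m + 2 * grid_floor n'.+1 m j)%N) ->
  0 <= t <= 1 ->
  `|perm_excursion R s t - phi0 t| <= (2 * (ramp n'.+1 m)%:R + 2) / n'.+1%:R.
Proof.
move=> m_gt0 mn hE /andP[t0 t1]; set n := n'.+1 in mn hE *.
set a := ramp n m in hE *; set q := half_block n m in hE *.
have n0 : 0 < n%:R :> R by rewrite ltr0n.
have m0 : 0 < m%:R :> R by rewrite ltr0n.
have N0 : 0 < (2 * n)%:R :> R by rewrite ltr0n.
have q0 : (0 < q)%N by exact: half_block_gt0.
have size_eq : (2 * a + m * (2 * q) = 2 * n)%N by exact: ramp_size.
have La : (2 * q <= a)%N by exact: block_le_ramp.
pose L := (2 * q)%N.
have L0 : (0 < L)%N by rewrite muln_gt0.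
pose k := Num.truncn (t * (2 * n)%:R).
have /andP[kt tk] : k%:R <= t * (2 * n)%:R < k.+1%:R by apply: truncn_itv; rewrite mulr_ge0// ltW.
have kn : (k <= 2 * n)%N.
  by rewrite -(ler_nat R); apply: le_trans kt _; rewrite ler_piMl// ltW.
pose j := minn ((k - a) %/ L) m.
have jm : (j <= m)%N by exact: geq_minr.
pose K := (a + j * L)%N.
have Kn : (K <= 2 * n)%N.
  have : (j * L <= m * L)%N by rewrite leq_mul2r jm orbT.
  by rewrite /K /L; lia.
have Kk : (k <= K + a)%N /\ (K <= k + a)%N.
  have dE := divn_eq (k - a) L; have dm := ltn_pmod (k - a) L0.
  rewrite /K /j /minn; case: ltnP => cmp.
    by move: dE dm; set x := (_ %/ _ * L)%N; set y := (_ %% _)%N; rewrite /L; lia.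
  have : (m * L <= (k - a) %/ L * L)%N by rewrite leq_mul2r cmp orbT.
  by move: dE dm; set x := (_ %/ _ * L)%N; set y := (_ %% _)%N; rewrite /L; lia.
pose x : R := K%:R / (2 * n)%:R.
have sE : perm_excursion R s x = (a + 2 * grid_floor n m j)%:R / (2 * n)%:R.
  by rewrite /x perm_excursion_grid// hE.
have tx : `|t - x| <= (a + 1)%:R / (2 * n)%:R.
  have -> : t - x = (t * (2 * n)%:R - K%:R) / (2 * n)%:R.
    by rewrite /x mulrBl mulfK// gt_eqF.
  rewrite normrM [`|_^-1|]ger0_norm ?invr_ge0 ?(ltW N0)// ler_pM2r ?invr_gt0//.
  have [k1 k2] := Kk.
  have k1' : k.+1%:R <= K%:R + (a + 1)%:R :> R by rewrite -natrD ler_nat; lia.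
  have k2' : K%:R <= k%:R + (a + 1)%:R :> R by rewrite -natrD ler_nat; lia.
  by rewrite ler_norml; apply/andP; split; lra.
have size_eqR : 2 * a%:R + m%:R * L%:R = (2 * n)%:R :> R.
  by rewrite -size_eq natrD !natrM.
have jm' : j%:R / m%:R <= 1 :> R by rewrite ler_pdivrMr// mul1r ler_nat.
have jm0 : 0 <= j%:R / m%:R :> R by rewrite divr_ge0.
have xj : `|x - j%:R / m%:R| <= a%:R / (2 * n)%:R.
  have -> : x - j%:R / m%:R = (a%:R - 2 * a%:R * (j%:R / m%:R)) / (2 * n)%:R.
    rewrite /x /K natrD natrM -size_eqR.
    by field; rewrite size_eqR !gt_eqF.
  rewrite normrM [`|_^-1|]ger0_norm ?invr_ge0 ?(ltW N0)// ler_pM2r ?invr_gt0//.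
  have : 0 <= a%:R * (j%:R / m%:R) :> R by rewrite mulr_ge0.
  have : a%:R * (j%:R / m%:R) <= a%:R :> R by rewrite ler_piMr.
  rewrite ler_norml => u1 u2; apply/andP; split; lra.
set p := phi0 (j%:R / m%:R).
have p0 : 0 <= p by exact: excursion_ge0.
have p1 : p <= 1 by apply: le_trans (excursion_le_id phi0 jm0) jm'.
have hp : `|perm_excursion R s x - p| <= (a + 2)%:R / (2 * n)%:R.
  have -> : perm_excursion R s x - p =
      (a%:R - 2 * (a%:R * p) + 2 * ((grid_floor n m j)%:R - grid_target n m j)) / (2 * n)%:R.
    rewrite sE /grid_target -/p -/q natrD natrM -size_eqR /L natrM.
    have nz : 2 * a%:R + m%:R * (2 * q%:R) != 0 :> R.
      by rewrite -(natrM _ 2 q) size_eqR gt_eqF.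
    by rewrite -[p in X in X = _](mulfK nz) -mulrBl; congr (_ / _); ring.
  rewrite normrM [`|_^-1|]ger0_norm ?invr_ge0 ?(ltW N0)// ler_pM2r ?invr_gt0//.
  have /andP[f1 f2] := grid_floor_itv n m j.
  have : 0 <= a%:R * p :> R by rewrite mulr_ge0.
  have : a%:R * p <= a%:R :> R by rewrite ler_piMr.
  rewrite ler_norml natrD => u1 u2; apply/andP; split; lra.
have l1 := excursion_lip (perm_excursion R s) t x.
have l2 := excursion_lip phi0 t x.
have l3 := excursion_lip phi0 x (j%:R / m%:R).
rewrite -/p in l3.
have -> : (2 * a%:R + 2) / n%:R =
    (a + 1)%:R / (2 * n)%:R + (a + 1)%:R / (2 * n)%:R + a%:R / (2 * n)%:R + (a + 2)%:R / (2
      * n)%:R :> R.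
  by rewrite !natrD natrM; field; rewrite gt_eqF.
have -> : perm_excursion R s t - phi0 t =
   (perm_excursion R s t - perm_excursion R s x) - (phi0 t - phi0 x) -
   (phi0 x - p) + (perm_excursion R s x - p) by ring.
apply: le_trans (ler_normD _ _) _; apply: lerD => //.
apply: le_trans (ler_normB _ _) _; apply: lerD; last exact: le_trans l3 xj.
apply: le_trans (ler_normB _ _) _; apply: lerD.
  exact: le_trans l1 tx.
exact: le_trans l2 tx.
Qed.

(** The slope of the discretised block differs from that of [phi0] by the rounding
    of two heights only. *)
Lemma shadowing_slope n m j : (0 < m)%N -> (m.+2 <= n)%N ->
  `|block_slope phi0 m j -
    (2 * (block_ups n m j)%:R - (2 * half_block n m)%:R) / (2 * half_block n m)%:R|
  <= (half_block n m)%:R^-1.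
Proof.
move=> m_gt0 mn; set q := half_block n m.
have q0 : 0 < q%:R :> R by rewrite ltr0n; exact: half_block_gt0.
have uE : (block_ups n m j)%:R =
    q%:R + (grid_floor n m j.+1)%:R - (grid_floor n m j)%:R :> R.
  rewrite /block_ups natrB ?natrD//.
  by have [_] := grid_floor_step n m j; rewrite addnC.
have -> : block_slope phi0 m j = (grid_target n m j.+1 - grid_target n m j) / q%:R.
  by rewrite grid_target_slope mulrC mulKf// gt_eqF.
rewrite uE natrM.
have /andP[a1 a2] := grid_floor_itv n m j; have /andP[b1 b2] := grid_floor_itv n m j.+1.
set g := (grid_floor n m j)%:R in a1 a2 *; set g' := (grid_floor n m j.+1)%:R in b1 b2 *.
have -> : (grid_target n m j.+1 - grid_target n m j) / q%:R -
  (2 * (q%:R + g' - g) - 2 * q%:R) / (2 * q%:R) =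
  (grid_target n m j.+1 - g' - (grid_target n m j - g)) / q%:R by field; rewrite gt_eqF.
rewrite normrM [`|_^-1|]ger0_norm ?invr_ge0 ?(ltW q0)// ler_piMl ?invr_ge0 ?(ltW q0)//.
by rewrite ler_norml; apply/andP; split; lra.
Qed.

Lemma ramp_le n m : (m.+2 <= n)%N ->
  (ramp n m)%:R <= 2 * n%:R / m.+2%:R + m%:R :> R.
Proof.
move=> mn; have M0 : 0 < m.+2%:R :> R by rewrite ltr0n.
have := lt_mqS n m; rewrite -(ltr_nat R) natrM.
have mqn : (m * half_block n m <= n)%N.
  by apply: leq_trans (mq_le n m); rewrite leq_mul2r ltnW ?orbT.
rewrite /ramp natrB// natrM.
set q := (half_block n m)%:R; rewrite -[(half_block n m).+1%:R]natr1 -/q => H.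
have H' : n%:R / m.+2%:R <= q + 1 by rewrite ler_pdivrMr// mulrC ltW.
have mE : m%:R = m.+2%:R - 2 :> R by rewrite -!natr1; ring.
have H2 : m%:R * (n%:R / m.+2%:R) <= m%:R * (q + 1) by rewrite ler_wpM2l.
have E : n%:R - m%:R * (n%:R / m.+2%:R) = 2 * n%:R / m.+2%:R :> R.
  by rewrite mE; field; rewrite gt_eqF.
have lin (N K x p z : R) : N - K * x = z -> K * x <= K * (p + 1) ->
  N - K * p <= z + K by lra.
exact: lin E H2.
Qed.

(** By [ln_bin_ge] the logarithm of the product is [2 * n * ln 2] minus [2 * n] times
    the block energy.  The errors are the steps lost to the ramps, of order
    [n / m], and a logarithm for each of the [m] blocks. *)
Lemma shadowing_count e : 0 < e -> exists M, forall m, (M < m)%N ->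
  \forall n \near \oo,
    expR (n%:R * (- (2 * I0) - e)) <= 4^-1 ^+ n * (\prod_(j < m) 'C(2 * half_block n m,
      block_ups n m j))%:R.
Proof.
move=> e0; have e16 : 0 < e / 16 by rewrite divr_gt0.
have [M1 HM] := block_energy_near phi0 e16.
have [M2 HM2] : exists M2, forall m, (M2 <= m)%N -> 4 / m.+2%:R <= e / 4 :> R.
  exists (Num.truncn (16 / e)) => m mM.
  have h : 16 / e < m.+2%:R :> R.
    have /andP[_ tr] := truncn_itv (ltW (divr_gt0 (ltr0n R 16) e0)).
    by apply: lt_le_trans tr _; rewrite ler_nat ltnW// !ltnS.
  rewrite ler_pdivrMr ?ltr0n//; move: h; rewrite ltr_pdivrMr// => h.
  lra.
exists (maxn M1 M2) => m; rewrite gtn_max => /andP[Mm1 Mm2].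
have m_gt0 : (0 < m)%N by exact: leq_ltn_trans Mm1.
have m0 : 0 < m%:R :> R by rewrite ltr0n.
have BE : block_energy phi0 m <= I0 + e / 16.
  have := HM m.-1; rewrite prednK// ler_norml => /(_ ltac:(lia))/andP[_ ?]; lra.
have Me : 4 / m.+2%:R <= e / 4 :> R by apply: HM2; lia.
pose sl j := block_slope phi0 m j.
have [d d0 Jd] := entropyJ_upper_near m sl e16.
have [C HC] := ln_sublinear_eventually (divr_gt0 e0 (mulr_gt0 (ltr0n R 16) m0) : 0 < e /
  (16 * m%:R)).
near=> n.
have mn : (m.+2 <= n)%N by near: n; exact: nbhs_infty_ge.
have n0 : 0 < n%:R :> R by rewrite ltr0n; lia.
pose q := half_block n m; pose a := ramp n m; pose L := (2 * q)%N.
have q0 : (0 < q)%N by exact: half_block_gt0.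
have L0 : (0 < L)%N by rewrite muln_gt0.
have size_eq : (2 * a + m * L = 2 * n)%N by exact: ramp_size.
have size_eqR : m%:R * L%:R = 2 * n%:R - 2 * a%:R :> R.
  by rewrite -!natrM -size_eq natrD addrAC subrr add0r.
have dq : q%:R^-1 < d.
  have : (m.+2 * (Num.truncn d^-1).+2 <= n)%N by near: n; exact: nbhs_infty_ge.
  rewrite mulnC -leq_divRL// -/q => tq.
  rewrite -[d]invrK ltf_pV2 ?posrE ?invr_gt0 ?ltr0n//.
  have d1 : 0 <= d^-1 by rewrite invr_ge0 ltW.
  have /andP[_ tr] := truncn_itv d1.
  by apply: lt_le_trans tr _; rewrite ler_nat ltnW.
have uL j : (block_ups n m j <= L)%N.
  by have [h1 h2] := grid_floor_step n m j; rewrite /block_ups /L -/q; lia.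
have bin_ge j : (j < m)%N ->
    L%:R * ln 2 - L%:R * (entropyJ (sl j) + e / 16) - 2 - 2 * ln L.+1%:R <=
    ln ('C(L, block_ups n m j)%:R : R).
  move=> jm; apply: le_trans (ln_bin_ge R L0 (uL j)).
  have sc := shadowing_slope j m_gt0 mn.
  have := Jd j _ jm (le_lt_trans sc dq).
  by rewrite -/q -/L -(ler_pM2l (_ : 0 < L%:R)) ?ltr0n// => H; lra.
rewrite natr_prod.
have -> : 4^-1 ^+ n = expR (- (2 * n%:R * ln 2)) :> R.
  rewrite -[4^-1]lnK ?posrE ?invr_gt0// -expRM_natl; congr expR.
  have -> : 4 = 2 ^+ 2 :> R by rewrite expr2 -natrM.
  by rewrite lnV ?posrE ?exprn_gt0// lnXn// mulr2n; ring.
have -> : \prod_(j < m) ('C(L, block_ups n m j))%:R =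
    expR (\sum_(j < m) ln ('C(L, block_ups n m j)%:R : R)).
  by rewrite expR_sum; apply: eq_bigr => j _; rewrite lnK// posrE ltr0n bin_gt0 uL.
rewrite -expRD ler_expR -lerBlDl opprK.
apply: (@le_trans _ _ (\sum_(j < m) (L%:R * ln 2 - L%:R * (entropyJ (sl j) + e / 16) - 2 -
  2 * ln L.+1%:R))); last first.
  by apply: ler_sum => j _; exact: bin_ge.
have -> : \sum_(j < m) (L%:R * ln 2 - L%:R * (entropyJ (sl j) + e / 16) - 2 - 2 * ln L.+1%:R) =
   m%:R * L%:R * ln 2 - m%:R * L%:R * (block_energy phi0 m + e / 16) - m%:R * (2 + 2 * ln
     L.+1%:R) :> R.
  have SE : \sum_(j < m) entropyJ (sl j) = m%:R * block_energy phi0 m.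
    by rewrite /block_energy mulrA mulfV ?mul1r ?gt_eqF.
  pose c := L%:R * ln 2 - L%:R * (e / 16) - 2 - 2 * ln L.+1%:R.
  rewrite (eq_bigr (fun j : 'I_m => c - L%:R * entropyJ (sl j))); last first.
    by move=> j _; rewrite /c; ring.
  rewrite sumrB sumr_const card_ord -[X in _ - X]mulr_sumr SE -[c *+ m]mulr_natl /c.
  by ring.
have J0 : 0 <= block_energy phi0 m.
  by rewrite mulr_ge0// sumr_ge0// => j _; exact/entropyJ_ge0/block_slope_le1.
have t1 : m%:R * L%:R * (block_energy phi0 m + e / 16) <= 2 * n%:R * (I0 + e / 8).
  apply: ler_pM; rewrite ?mulr_ge0 ?addr_ge0 ?(ltW e16)//.
    by rewrite size_eqR gerBl mulr_ge0.
  by lra.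
have ln2 : 0 <= ln (2 : R) <= 1.
  have := ln_le_subr1 (ltr0n R 2); rewrite ln_ge0//=; last by rewrite ler1n.
  by lra.
have t2 : 2 * a%:R * ln (2 : R) <= 4 * n%:R / m.+2%:R + 2 * m%:R.
  apply: (@le_trans _ _ (2 * a%:R)).
    by rewrite ler_piMr ?mulr_ge0//; case/andP: ln2.
  have lin (A N iv M : R) : A <= 2 * N * iv + M -> 2 * A <= 4 * N * iv + 2 * M by lra.
  exact: lin (ramp_le mn).
have t3 : m%:R * ln (L.+1%:R : R) <= e / 16 * (3 * n%:R) + m%:R * C.
  have Ln : L.+1%:R <= 3 * n%:R :> R.
    rewrite -natrM ler_nat; have := leq_pmull L m_gt0; move: size_eq mn.
    by clear; generalize (m * L)%N L a; lia.
  apply: (@le_trans _ _ (m%:R * (e / (16 * m%:R) * (3 * n%:R) + C))).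
    rewrite ler_wpM2l//; apply: le_trans (HC _ _) _; first by rewrite ltr0n.
    by rewrite lerD2r ler_wpM2l// ltW// divr_gt0// mulr_gt0.
  rewrite mulrDr lerD2r le_eqVlt; apply/orP; left; apply/eqP.
  by field; rewrite gt_eqF.
have t4 : 4 * n%:R / m.+2%:R <= n%:R * (e / 4) :> R.
  by rewrite -mulrA mulrCA ler_wpM2l// ltW.
have t5 : 4 * m%:R + 2 * (m%:R * C) <= n%:R * (e / 8).
  have : 8 / e * (4 * m%:R + 2 * (m%:R * C)) <= n%:R by near: n; exact: nbhs_infty_ger.
  by rewrite mulrAC ler_pdivrMr//; lra.
move: ln2 t1 t2 t3 t4 t5; rewrite size_eqR => /andP[l0 l1].
set X := ln L.+1%:R; set Y := 4 * n%:R / _; set l2 := ln 2; set B := block_energy _ _.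
move=> t1 t2 t3 t4 t5.
have {}t1 : (2 * n%:R - 2 * a%:R) * (B + e / 16) <= 2 * n%:R * (I0 + e / 8) by [].
move: t1 t2 t3 t4 t5; set I := Rintegral _ _ _.
lra.
Unshelve. all: by end_near. Qed.

End LowerCount.

(** * The Mallows law *)

Lemma near_predn (P : nat -> Prop) :
  (\forall n \near \oo, P n) -> \forall n \near \oo, P n.-1.
Proof.
by move=> [N _ HN]; exists N.+1 => // n /= Nn; apply: HN => /=; case: n Nn.
Qed.

Section LocalEstimates.
Variables (R : realType) (beta : R).
Local Notation lambda := (@lebesgue_measure R).
Implicit Type phi : excursion R.

Lemma avoiders_in_close n' phi d (s : 'S_n'.+1) :
  s \in avoiders_in n'.+1
    [set psi : excursion R | forall t, 0 <= t <= 1 -> `|phi t - psi t| < d] ->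
  avoids231 s /\ forall t, 0 <= t <= 1 -> `|phi t - perm_excursion R s t| < d.
Proof. by rewrite inE => /andP[av /asboolP]. Qed.

(** On a small ball the area is almost constant, and so is the weight by
    [weight_bound]; the sum over the ball is controlled by [upper_count]. *)
Lemma total_weight_upper phi e : 0 < e -> exists2 V, nbhs phi V &
  \forall n \near \oo, total_weight beta n V <=
    expR (n%:R * (- path_energy beta phi + e)).
Proof.
move=> e0; have e4 : 0 < e / 4 by rewrite divr_gt0.
have [d d0 [C [N _ H]]] := upper_count phi e4.
pose b := 8 * (`|beta| + 1).
have b0 : 0 < b by rewrite mulr_gt0// ltr_wpDl.
pose d' := Num.min d (e / b).
have d'0 : 0 < d' by rewrite lt_min d0 divr_gt0.
have d'd : d' <= d by rewrite ge_min lexx.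
have d'b : 2 * `|beta| * d' <= e / 4.
  apply: (@le_trans _ _ (2 * `|beta| * (e / b))).
    by rewrite ler_wpM2l ?mulr_ge0// ge_min lexx orbT.
  rewrite mulrA ler_pdivrMr// /b.
  have -> : e / 4 * (8 * (`|beta| + 1)) = 2 * `|beta| * e + 2 * e by field.
  by rewrite lerDl mulr_ge0// ltW.
exists [set psi : excursion R | forall t, 0 <= t <= 1 -> `|phi t - psi t| < d'].
  by apply/excursion_nbhsP; exists d'.
set V := [set psi : excursion R | _].
near=> k.
have n0 : (0 < k)%N by near: k; exact: nbhs_infty_gt.
have HN : (N <= k.-1)%N by near: k; apply: (@near_predn (fun n => N <= n)%N); exact:
  nbhs_infty_ge.
have nC : C + 2 * `|beta| <= k%:R * (e / 4).
  have : 4 / e * (C + 2 * `|beta|) <= k%:R by near: k; exact: nbhs_infty_ger.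
  by rewrite mulrAC ler_pdivrMr//; lra.
move: n0 HN nC; case: (k) => // n' _ HN nC; set n := n'.+1 in nC *.
have HS := H n' HN (avoiders_in n V).
have {HS} := HS (fun s sV => let: conj av cl := avoiders_in_close sV in
  conj av (fun t t01 => le_trans (ltW (cl t t01)) d'd)).
move=> cardS.
pose W := expR (n%:R * (2 * beta * \int[lambda]_(t in `[0, 1]) phi t + 2 * `|beta| * d') +
  2 * `|beta|).
have sumW : \sum_(s in avoiders_in n V) weight beta s <= #|avoiders_in n V|%:R * W.
  rewrite mulr_natl -sumr_const; apply: ler_sum => s /avoiders_in_close[av cl].
  have close : `| \int[lambda]_(t in `[0, 1]) perm_excursion R s t -
     \int[lambda]_(t in `[0, 1]) phi t | <= d'.
    by rewrite distrC; apply: excursion_integral_close => t /cl/ltW.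
  by have /andP[] := weight_bound beta av close.
rewrite /total_weight; apply: (@le_trans _ _ (4^-1 ^+ n * (#|avoiders_in n V|%:R * W))).
  by rewrite ler_pM2l// exprn_gt0.
rewrite mulrA; apply: le_trans (ler_wpM2r (expR_ge0 _) cardS) _.
rewrite -expRD ler_expR /path_energy -/n.
have nb : n%:R * (2 * `|beta| * d') <= n%:R * (e / 4) by rewrite ler_wpM2l.
have n0 : 0 <= n%:R * e by rewrite mulr_ge0// ltW.
move: nb nC n0; set I := Rintegral _ _ _; set K := Rintegral _ _ _.
set B := `|beta|; lra.
Unshelve. all: by end_near. Qed.

(** Only the permutations provided by [shadowing_excursions] are retained. *)
Lemma total_weight_lower phi V e : nbhs phi V -> 0 < e ->
  \forall n \near \oo,
    expR (n%:R * (- path_energy beta phi - e)) <= total_weight beta n V.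
Proof.
move=> /excursion_nbhsP[r r0 rV] e0; have e4 : 0 < e / 4 by rewrite divr_gt0.
pose b := 8 * (`|beta| + 1).
have b0 : 0 < b by rewrite mulr_gt0// ltr_wpDl.
pose d := Num.min (r / 2) (e / b).
have d0 : 0 < d by rewrite lt_min !divr_gt0.
have dr : d < r by rewrite gt_min; apply/orP; left; lra.
have db : 2 * `|beta| * d <= e / 4.
  apply: (@le_trans _ _ (2 * `|beta| * (e / b))).
    by rewrite ler_wpM2l ?mulr_ge0// ge_min lexx orbT.
  rewrite mulrA ler_pdivrMr// /b.
  have -> : e / 4 * (8 * (`|beta| + 1)) = 2 * `|beta| * e + 2 * e by field.
  by rewrite lerDl mulr_ge0// ltW.
have [M HM] := shadowing_count phi e4.
(* The ramps take up a fraction of order [1 / m] of the path, which has to be small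
   compared with the radius [d]. *)
pose m := (maxn M (Num.truncn (8 / d))).+1.
have md : 4 / m.+2%:R <= d / 2.
  have /andP[_ tr] := truncn_itv (ltW (divr_gt0 (ltr0n R 8) d0)).
  have : 8 / d < m.+2%:R.
    apply: lt_le_trans tr _; rewrite ler_nat /m !ltnS ltnW// ltnW// ltnS.
    exact: leq_maxr.
  by rewrite ltr_pdivrMr// ler_pdivrMr ?ltr0n// => h; lra.
have {}HM := HM m ltac:(by rewrite ltnS leq_maxl).
have m0 : (0 < m)%N by [].
near=> k.
have mn : (m.+2 <= k)%N by near: k; exact: nbhs_infty_ge.
have HMn : expR (k%:R * (- (2 * \int[lambda]_(t in `[0, 1]) entropyJ (derive1 phi t)) - e / 4)) <=
    4^-1 ^+ k * (\prod_(j < m) 'C(2 * half_block k m, block_ups phi k m j))%:R by near: k.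
have nm : 2 * m%:R + 2 <= k%:R * (d / 2).
  have : 2 / d * (2 * m%:R + 2) <= k%:R by near: k; exact: nbhs_infty_ger.
  by rewrite mulrAC ler_pdivrMr//; lra.
have nB : 2 * `|beta| <= k%:R * (e / 2).
  have : 2 / e * (2 * `|beta|) <= k%:R by near: k; exact: nbhs_infty_ger.
  by rewrite mulrAC ler_pdivrMr//; lra.
move: mn HMn nm nB; case: (k) => // n' mn HMn nm nB; set n := n'.+1 in mn HMn nm nB *.
have n0 : 0 < n%:R :> R by rewrite ltr0n.
have [S [SP cardS]] := shadowing_excursions phi m0 mn.
have close s t : s \in S -> 0 <= t <= 1 -> `|phi t - perm_excursion R s t| <= d.
  move=> /SP[av hE] t01; rewrite distrC.
  apply: le_trans (shadowing_close m0 mn hE t01) _.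
  have lin (A N iv K p : R) : A <= 2 * N * iv + K -> 4 * iv <= p / 2 -> 0 < N ->
      2 * K + 2 <= N * (p / 2) -> 2 * A + 2 <= p * N by nra.
  by rewrite ler_pdivrMr//; exact: lin (ramp_le R mn) md n0 nm.
have Sin : S \subset avoiders_in n V.
  apply/fintype.subsetP => s sS; have [av _] := SP s sS.
  rewrite inE av/=; apply/asboolP; apply: rV => t t01.
  exact: le_lt_trans (close s t sS t01) dr.
pose W := expR (n%:R * (2 * beta * \int[lambda]_(t in `[0, 1]) phi t - 2 * `|beta| * d) - 2
  * `|beta|).
have sumW : #|S|%:R * W <= \sum_(s in avoiders_in n V) weight beta s.
  apply: (@le_trans _ _ (\sum_(s in S) weight beta s)).
    rewrite mulr_natl -sumr_const; apply: ler_sum => s sS.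
    have close' : `| \int[lambda]_(t in `[0, 1]) perm_excursion R s t -
       \int[lambda]_(t in `[0, 1]) phi t | <= d.
      by rewrite distrC; apply: excursion_integral_close => t; exact: close.
    by have /andP[] := weight_bound beta (SP s sS).1 close'.
  by apply: ler_sum_subset => // s; exact: ltW (weight_gt0 _ _).
rewrite /total_weight; apply: (@le_trans _ _ (4^-1 ^+ n * (#|S|%:R * W))); last first.
  by rewrite ler_pM2l// exprn_gt0.
rewrite mulrA; apply: (@le_trans _ _ (expR (n%:R * (- (2 * \int[lambda]_(t in `[0, 1])
  entropyJ (derive1 phi t)) - e / 4)) * W)); last first.
  rewrite ler_wpM2r ?expR_ge0//; apply: le_trans HMn _.
  by rewrite ler_wpM2l ?exprn_ge0// ler_nat.
rewrite -expRD ler_expR /path_energy.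
have nb : n%:R * (2 * `|beta| * d) <= n%:R * (e / 4) by rewrite ler_wpM2l// ltW.
move: nb nB; set I := Rintegral _ _ _; set K := Rintegral _ _ _.
set B := `|beta|; lra.
Unshelve. all: by end_near. Qed.

Lemma total_weight0 n : total_weight beta n set0 = 0.
Proof.
rewrite /total_weight big1 ?mulr0// => s; rewrite inE => /andP[_ /asboolP].
by [].
Qed.

Lemma avoiders_inS n (V V' : set (excursion R)) : V `<=` V' ->
  avoiders_in n V \subset avoiders_in n V'.
Proof.
move=> VV'; apply/fintype.subsetP => s; rewrite !inE => /andP[-> /asboolP Vs] /=.
by apply/asboolP; exact: VV'.
Qed.

Lemma total_weightS n V V' : V `<=` V' ->
  total_weight beta n V <= total_weight beta n V'.
Proof.
move=> VV'; rewrite ler_pM2l ?exprn_gt0//.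
apply: ler_sum_subset => [|s]; first exact: avoiders_inS.
exact: ltW (weight_gt0 _ _).
Qed.

Lemma total_weightU n V V' :
  total_weight beta n (V `|` V') <= total_weight beta n V + total_weight beta n V'.
Proof.
rewrite -mulrDr ler_pM2l ?exprn_gt0//.
rewrite ![\sum_(s in _) _]big_mkcond/= -big_split/=; apply: ler_sum => s _.
have ws := ltW (weight_gt0 beta s).
rewrite !inE asbool_or; case: (avoids231 s) => /=; last by rewrite addr0.
by case: `[< _ >]; case: `[< _ >]; rewrite /= ?addr0 ?add0r// lerDl.
Qed.

End LocalEstimates.

Section Law.
Variable R : realType.

(** The normalising constant of the unconditioned law cancels. *)
Lemma mallows231E n (q : R) (s : 'S_n) : 0 < q -> avoids231 s ->
  mallows231 q s = q ^+ inversions s / \sum_(r : 'S_n | avoids231 r) q ^+ inversions r.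
Proof.
move=> q0 av; rewrite /mallows231 av /mallows.
rewrite -mulr_suml.
set Z := \sum_(r : 'S_n) q ^+ inversions r.
have Z0 : Z != 0.
  rewrite gt_eqF// /Z (bigD1 s)//= ltr_pwDl ?exprn_gt0// sumr_ge0// => r _.
  by rewrite exprn_ge0// ltW.
set Y := \sum_(r | _) _.
have Y0 : Y != 0.
  rewrite gt_eqF// /Y (bigD1 s)//= ltr_pwDl ?exprn_gt0// sumr_ge0// => r _.
  by rewrite exprn_ge0// ltW.
by field; rewrite Z0 Y0.
Qed.

Section FiniteLaw.
Context d (Omega : measurableType d) (P : probability Omega R) (n : nat).
Variable tau : Omega -> 'S_n.
Hypothesis measurable_tau : forall s : 'S_n, measurable (tau @^-1` [set s]).

Lemma preimage_finite (D : {set 'S_n}) :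
  tau @^-1` [set s | s \in D] = \bigcup_(s in [set` enum D]) tau @^-1` [set s].
Proof.
apply/seteqP; split=> [w /= wD|w [s /= sD ws]].
  by exists (tau w) => //=; rewrite mem_enum.
by rewrite /= ws; rewrite mem_enum in sD.
Qed.

Lemma measurable_finite_preimage (D : {set 'S_n}) :
  measurable (tau @^-1` [set s | s \in D]).
Proof.
rewrite preimage_finite; apply: fin_bigcup_measurable; first exact: finite_seq.
by move=> s _; exact: measurable_tau.
Qed.

Lemma law_finite (D : {set 'S_n}) :
  P (tau @^-1` [set s | s \in D]) = (\sum_(s in D) P (tau @^-1` [set s]))%E.
Proof.
rewrite preimage_finite measure_fin_bigcup//=.
- by rewrite -fsbig_seq ?enum_uniq// big_enum.
- by move=> s s' _ _ [w [/= <- <-]].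
Qed.

End FiniteLaw.

Lemma preimage_perm_excursion n (Omega : Type) (tau : Omega -> 'S_n)
    (V : set (excursion R)) :
  (fun w => perm_excursion R (tau w)) @^-1` V =
  tau @^-1` [set s | s \in [set s | `[< V (perm_excursion R s) >]]%SET].
Proof. by apply/seteqP; split=> w /=; rewrite inE => /asboolP. Qed.

End Law.

Section MallowsLaw.
Context (R : realType) (beta : R) (d : measure_display).
Context (Omega : measurableType d) (P : probability Omega R) (n : nat).
Variable tau : Omega -> 'S_n.
Hypothesis n0 : (0 < n)%N.
Hypothesis measurable_tau : forall s : 'S_n, measurable (tau @^-1` [set s]).
Hypothesis tau_law : forall s : 'S_n,
  P (tau @^-1` [set s]) = (mallows231 (expR (beta / n%:R)) s)%:E.

Lemma excursion_law V :
  P ((fun w => perm_excursion R (tau w)) @^-1` V) =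
  (total_weight beta n V / total_weight beta n setT)%:E.
Proof.
rewrite preimage_perm_excursion law_finite// (eq_bigr _ (fun s _ => tau_law s)) sumEFin;
  congr EFin.
rewrite /total_weight -mulf_div divff ?expf_neq0 ?invr_eq0// mul1r mulr_suml.
rewrite (bigID (@avoids231 n))/= [X in _ + X]big1 ?addr0; last first.
  by move=> s /andP[_ /negbTE nav]; rewrite /mallows231 nav.
rewrite (eq_bigl (mem (avoiders_in n V))); last first.
  by move=> s; rewrite !inE andbC.
apply: eq_bigr => s; rewrite /= inE => /andP[av _].
rewrite mallows231E ?expR_gt0//; congr (_ / _).
by apply: eq_bigl => r; rewrite inE asboolT// andbT.
Qed.

End MallowsLaw.

Theorem corollary31 (R : realType) (beta : R)
    (d : nat -> measure_display) (Omega : forall n, measurableType (d n))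
    (P : forall n, probability (Omega n) R)
    (tau : forall n, Omega n -> 'S_n)
    (measurable_tau : forall n (s : 'S_n), measurable (tau n @^-1` [set s]))
    (tau_law : forall n (s : 'S_n), (0 < n)%N ->
      P n (tau n @^-1` [set s]) = (mallows231 (expR (beta / n%:R)) s)%:E) :
  large_deviation_principle P
    (fun n w => perm_excursion R (tau n w))
    (fun n => n%:R)
    (fun phi : excursion R =>
      (path_energy beta phi - inf (range (@path_energy R beta)))%:E).
Proof.
pose X n (w : Omega n) := perm_excursion R (tau n w).
have mX n V : measurable (X n @^-1` V).
  by rewrite /X preimage_perm_excursion; exact: measurable_finite_preimage.
pose p n V := fine (P n (X n @^-1` V)).
have pE n V : (p n V)%:E = P n (X n @^-1` V) by rewrite fineK// fin_num_measure.
have logpE V : (fun n => n%:R^-1%:E * lne (P n (X n @^-1` V)))%E =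
    (fun n => n%:R^-1%:E * lne (p n V)%:E)%E by apply/funext => n; rewrite pE.
have pw n V : (0 < n)%N ->
    p n V = total_weight beta n V / total_weight beta n setT.
  by move=> n0; rewrite /p (@excursion_law R beta _ _ _ _ (tau n))// => s; exact: tau_law.
have T0 : [set: excursion R] !=set0 by exists (excursion0 R).
have cptT := @excursion_compact R.
have w0 := @total_weight0 R beta.
have wS := @total_weightS R beta.
have wU := @total_weightU R beta.
have upper := @total_weight_upper R beta.
have lower := @total_weight_lower R beta.
split.
- by split=> [n U _|]; [exact: mX|exact: cvgr_idn].
- split=> [phi|].
    exact: (rate_ge0 cptT upper lower).
  exact: (rate_lower_semicontinuous upper lower).
- move=> F cF; rewrite logpE.
  exact: (ldp_upper cptT w0 wS wU upper lower T0 pw cF).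
- move=> U oU; rewrite logpE.
  exact: (ldp_lower cptT w0 wS wU upper lower T0 pw oU).
Qed.
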